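(* A $5$-dimensional real solvable Lie algebra admits a hypo-contact structure if and only if it is isomorphic to one of the following Lie algebras $\mathfrak h_1,\dots,\mathfrak h_5$, each given by its nonzero brackets (up to skew-symmetry) in a basis $X_1,\dots,X_5$: $$\begin{array}{rl} \mathfrak h_{1}: & [X_1,X_4]=[X_2,X_3]=X_5;\\ \mathfrak h_{2}: & \tfrac12[X_1,X_5]=[X_2,X_3]=X_1,\ [X_2,X_5]=X_2,\ [X_3,X_5]=X_3,\ [X_4,X_5]=-3X_4;\\ \mathfrak h_{3}: & \tfrac12[X_1,X_4]=[X_2,X_3]=X_1,\ [X_2,X_4]=[X_3,X_5]=X_2,\ [X_2,X_5]=-[X_3,X_4]=-X_3;\\ \mathfrak h_{4}: & [X_1,X_4]=X_1,\ [X_2,X_5]=X_2,\ [X_3,X_4]=[X_3,X_5]=-X_3;\\ \mathfrak h_{5}: & [X_1,X_5]=[X_2,X_4]=X_1,\ [X_3,X_4]=X_2,\ [X_3,X_5]=-X_3,\ [X_4,X_5]=X_4. \end{array}$$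
   Context: For a real Lie algebra $\mathfrak g$, $d$ is the Chevalley–Eilenberg differential on $\Lambda^*\mathfrak g^*$, so $d\alpha(X,Y)=-\alpha([X,Y])$ for $\alpha\in\mathfrak g^*$. An $SU(2)$-structure on a $5$-dimensional Lie algebra $\mathfrak g$ is a quadruplet $(\eta,\omega_1,\omega_2,\omega_3)$ with $\eta\in\mathfrak g^*$ nonzero and $\omega_i\in\Lambda^2\mathfrak g^*$ such that $\omega_i\wedge\omega_j=\delta_{ij}v$ for some $v\in\Lambda^4\mathfrak g^*$ with $v\wedge\eta\neq0$, and $i_X\omega_3=i_Y\omega_1\Rightarrow\omega_2(X,Y)\ge0$ (where $i_X$ is contraction). Equivalently, there is a basis $e^1,\dots,e^5$ of $\mathfrak g^*$ with $\eta=e^5$, $\omega_1=e^{12}+e^{34}$, $\omega_2=e^{13}+e^{42}$, $\omega_3=e^{14}+e^{23}$, where $e^{ij}=e^i\wedge e^j$. It is a hypo-contact structure if $d\eta=-2\omega_3$, $d(\eta\wedge\omega_1)=0$, $d(\eta\wedge\omega_2)=0$. *)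

(* Defs.v *)
From HB Require Import structures.
From mathcomp Require Import all_boot all_order all_algebra all_fingroup.
From mathcomp Require Import reals.
From mathcomp Require Import ring.

Set Implicit Arguments.
Unset Strict Implicit.
Unset Printing Implicit Defensive.

Import Order.TTheory GRing.Theory Num.Theory.

Local Open Scope ring_scope.

HB.mixin Record Vector_isLieAlgebra (F : fieldType) V of Vector F V := {
  lie : V -> V -> V;
  lie_linearl : forall y : V, linear (lie^~ y);
  lie_linearr : forall x : V, linear (lie x);
  liexx : forall x : V, lie x x = 0;
  lie_jacobi : forall x y z : V,
    lie x (lie y z) + lie y (lie z x) + lie z (lie x y) = 0
}.

#[short(type="lieAlgType")]
HB.structure Definition LieAlgebra (F : fieldType) :=
  { V of Vector_isLieAlgebra F V & Vector F V }.

Section LieTheory.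

Variables (F : fieldType) (g : lieAlgType F).

Definition derived (U : {vspace g}) : {vspace g} :=
  <<allpairs (@lie F g) (vbasis U) (vbasis U)>>%VS.

Definition lie_solvable : Prop :=
  exists n, iter n derived {:g}%VS = 0%VS.

(* [derived U] does not depend on the basis: it is the span of all brackets. *)
Lemma derivedP (U W : {vspace g}) :
  (forall x y, x \in U -> y \in U -> lie x y \in W) <-> (derived U <= W)%VS.
Proof.
split=> [UW | /subvP UW x y Ux Uy].
  apply/span_subvP => _ /allpairsP[[x y] /= [Ux Uy ->]].
  by apply: UW; apply: vbasis_mem.
pose lx z : {linear g -> g} :=
  HB.pack (fun u => lie u z) (GRing.isLinear.Build F g g _ _ (lie_linearl z)).
pose ly z : {linear g -> g} :=
  HB.pack (fun u => lie z u) (GRing.isLinear.Build F g g _ _ (lie_linearr z)).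
rewrite (coord_vbasis Ux) -[lie _ _]/(lx y _) linear_sum memv_suml // => i _.
rewrite linearZ memvZ //= -[lie _ _]/(ly _ y).
rewrite (coord_vbasis Uy) linear_sum memv_suml // => j _.
rewrite linearZ memvZ //= UW // memv_span //.
by apply/allpairsP; exists ((vbasis U)`_i, (vbasis U)`_j); rewrite !mem_nth ?size_tuple.
Qed.

End LieTheory.

Definition lie_isomorphic (F : fieldType) (g h : lieAlgType F) : Prop :=
  exists f : {linear g -> h},
    bijective f /\ forall x y, f (lie x y) = lie (f x) (f y).

Section Forms.

Variables (F : fieldType) (V : vectType F).

(* Elements of Lambda^k V^* are the functions on k-tuples of vectors
   satisfying [is_altform]. *)
Definition kform (k : nat) := k.-tuple V -> F.

Definition tset (k : nat) (t : k.-tuple V) (i : 'I_k) (x : V) : k.-tuple V :=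
  [tuple if j == i then x else tnth t j | j < k].

Definition is_altform (k : nat) (a : kform k) : Prop :=
  (forall (t : k.-tuple V) (i : 'I_k) (c : F) (x y : V),
      a (tset t i (c *: x + y)) = c * a (tset t i x) + a (tset t i y)) /\
  (forall (t : k.-tuple V) (i j : 'I_k),
      i != j -> tnth t i = tnth t j -> a t = 0).

Definition form_nonzero (k : nat) (a : kform k) : Prop := exists t, a t != 0.

(* Determinant convention: (a ^ b)(X, Y) = a(X) b(Y) - a(Y) b(X) on 1-forms.
   The factorials are assumed invertible in F. *)
Definition wedge (p q : nat) (a : kform p) (b : kform q) : kform (p + q) :=
  fun t => ((p`! * q`!)%:R)^-1 *
    \sum_(s : 'S_(p + q)) (-1) ^+ s *
       a [tuple tnth t (s (lshift q i)) | i < p] *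
       b [tuple tnth t (s (rshift p i)) | i < q].

Definition contract (k : nat) (x : V) (a : kform k.+1) : kform k :=
  fun t => a [tuple of x :: t].

End Forms.

(* (d a)(X_0, .., X_k) =
     \sum_(i < j) (-1)^(i+j) a([X_i, X_j], X_0, .., ^X_i, .., ^X_j, .., X_k)
   in positive degree (d vanishes on constants). When i < j, the value of
   [lift j i] is i, and [fun l => lift j (lift i l)] enumerates the indices
   other than i and j in increasing order. *)
Definition CEd (F : fieldType) (g : lieAlgType F) (k : nat)
    (a : kform g k.+1) : kform g k.+2 :=
  fun t => \sum_(j < k.+2) \sum_(i < k.+1 | (i < j)%N)
    (-1) ^+ (i + j) *
    a [tuple of lie (tnth t (lift j i)) (tnth t j)
             :: [tuple tnth t (lift j (lift i l)) | l < k]].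

Section HypoContact.

Variables (R : realType) (g : lieAlgType R).

Definition SU2_structure (eta : kform g 1) (w1 w2 w3 : kform g 2) : Prop :=
  let w := tnth [tuple w1; w2; w3] in
  [/\ is_altform eta /\ form_nonzero eta,
      forall i, is_altform (w i),
      exists v : kform g 4,
        [/\ is_altform v,
            forall i j : 'I_3, wedge (w i) (w j) =1 fun t => (i == j)%:R * v t
          & form_nonzero (wedge v eta)]
    & forall X Y : g, contract X w3 =1 contract Y w1 -> 0 <= w2 [tuple X; Y]].

Definition hypo_contact (eta : kform g 1) (w1 w2 w3 : kform g 2) : Prop :=
  [/\ SU2_structure eta w1 w2 w3,
      CEd eta =1 (fun t => - 2 * w3 t),
      CEd (wedge eta w1) =1 (fun=> 0)
    & CEd (wedge eta w2) =1 (fun=> 0)].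

Definition admits_hypo_contact : Prop :=
  exists (eta : kform g 1) (w1 w2 w3 : kform g 2), hypo_contact eta w1 w2 w3.

End HypoContact.

Section Tables.

Variable R : realType.

(* X k is the k-th vector of the standard basis of R^5, for 1 <= k <= 5. *)
Definition X (k : nat) : 'rV[R]_5 := delta_mx 0 (inord k.-1).

(* An entry (i, j, v) of a table stands for [X_i, X_j] = v = - [X_j, X_i];
   pairs not listed commute. *)
Definition table := seq (nat * nat * 'rV[R]_5).

Definition table_lie (T : table) (x y : 'rV[R]_5) : 'rV[R]_5 :=
  \sum_(e <- T)
    (x 0 (inord e.1.1.-1) * y 0 (inord e.1.2.-1)
     - x 0 (inord e.1.2.-1) * y 0 (inord e.1.1.-1)) *: e.2.

Definition jacobi (T : table) : Prop := forall x y z : 'rV[R]_5,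
  table_lie T x (table_lie T y z) + table_lie T y (table_lie T z x)
  + table_lie T z (table_lie T x y) = 0.

Definition table_alg (T : table) (JT : jacobi T) : Type := 'rV[R]_5.

Lemma table_lie_linearl (T : table) y : linear ((table_lie T)^~ y).
Proof.
move=> c x x'; rewrite /table_lie scaler_sumr -big_split /=.
apply: eq_bigr => e _; rewrite !mxE scalerA -scalerDl; congr (_ *: _); ring.
Qed.

Lemma table_lie_linearr (T : table) x : linear (table_lie T x).
Proof.
move=> c y y'; rewrite /table_lie scaler_sumr -big_split /=.
apply: eq_bigr => e _; rewrite !mxE scalerA -scalerDl; congr (_ *: _); ring.
Qed.

Lemma table_liexx (T : table) x : table_lie T x x = 0.
Proof. by rewrite /table_lie big1 // => e _; rewrite mulrC subrr scale0r. Qed.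

HB.instance Definition _ (T : table) (JT : jacobi T) :=
  Vector.on (table_alg JT).
HB.instance Definition _ (T : table) (JT : jacobi T) :=
  Vector_isLieAlgebra.Build R (table_alg JT)
    (@table_lie_linearl T) (@table_lie_linearr T) (@table_liexx T) JT.

Definition T1 : table := [:: (1, 4, X 5); (2, 3, X 5)].

Definition T2 : table :=
  [:: (1, 5, 2 *: X 1); (2, 3, X 1); (2, 5, X 2); (3, 5, X 3);
      (4, 5, - 3 *: X 4)].

Definition T3 : table :=
  [:: (1, 4, 2 *: X 1); (2, 3, X 1); (2, 4, X 2); (3, 5, X 2);
      (2, 5, - X 3); (3, 4, X 3)].

Definition T4 : table :=
  [:: (1, 4, X 1); (2, 5, X 2); (3, 4, - X 3); (3, 5, - X 3)].

Definition T5 : table :=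
  [:: (1, 5, X 1); (2, 4, X 1); (3, 4, X 2); (3, 5, - X 3); (4, 5, X 4)].

Let co (x : 'rV[R]_5) (k : nat) : R := x 0 (inord k).

Let coT T x y k : co (table_lie T x y) k =
  foldr (fun e s => (co x e.1.1.-1 * co y e.1.2.-1
    - co x e.1.2.-1 * co y e.1.1.-1) * co e.2 k + s) 0 T.
Proof.
rewrite /co /table_lie summxE; elim: T => [|e T IH]; first by rewrite big_nil.
by rewrite big_cons IH /= mxE.
Qed.

Let coX i k : (i.-1 < 5)%N -> (k < 5)%N -> co (X i) k = (k == i.-1)%:R.
Proof. by move=> *; rewrite /co mxE eqxx -(inj_eq val_inj) /= !inordK. Qed.

Let coN x k : co (- x) k = - co x k. Proof. by rewrite /co mxE. Qed.

Let coZ c x k : co (c *: x) k = c * co x k. Proof. by rewrite /co mxE. Qed.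

Let jacobi_co T :
  (forall x y z k, (k < 5)%N ->
     co (table_lie T x (table_lie T y z)) k
     + co (table_lie T y (table_lie T z x)) k
     + co (table_lie T z (table_lie T x y)) k = 0) ->
  jacobi T.
Proof.
move=> H x y z; apply/rowP => k; rewrite -(inord_val k) !mxE.
by rewrite [LHS]H ?mxE.
Qed.

Local Ltac simp_co :=
  rewrite ?coZ ?coN !coX //= ?oppr0 ?mulr0 ?add0r ?addr0 ?mulr1.

Local Ltac jacobi_tac :=
  apply: jacobi_co => x y z [|[|[|[|[|?]]]]] // _;
  rewrite !coT /=; simp_co; rewrite ?coT /=; try simp_co; ring.

Lemma J1 : jacobi T1. Proof. jacobi_tac. Qed.
Lemma J2 : jacobi T2. Proof. jacobi_tac. Qed.
Lemma J3 : jacobi T3. Proof. jacobi_tac. Qed.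
Lemma J4 : jacobi T4. Proof. jacobi_tac. Qed.
Lemma J5 : jacobi T5. Proof. jacobi_tac. Qed.

Definition h1 : lieAlgType R := table_alg J1.
Definition h2 : lieAlgType R := table_alg J2.
Definition h3 : lieAlgType R := table_alg J3.
Definition h4 : lieAlgType R := table_alg J4.
Definition h5 : lieAlgType R := table_alg J5.

End Tables.

(* Main.v *)
(* A solvable g carries a nonzero closed 1-form.  Rotating an adapted frame by
   SU(2), this form becomes a multiple of e^1 + a e^5 with e^5 = eta.  The
   hypo-contact equations are then linear in the structure constants and leave
   twelve parameters besides a: a symmetric 3x3 matrix and six entries of the
   bracket with the Reeb vector.  Rotating e^2 and e^3 brings the matrix to a
   normal form, and the Jacobi identity determines the remaining entries and
   turns into cubic equations on the matrix, which factor.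
   Each branch is isomorphic to one of h1, ..., h5, except one which has a
   quotient sl(2, R) and is excluded by solvability. *)

From HB Require Import structures.
Require Import Defs.
From mathcomp Require Import all_boot all_order all_algebra reals.
From mathcomp Require Import all_fingroup.
From mathcomp Require Import ring lra.

Set Implicit Arguments.
Unset Strict Implicit.
Unset Printing Implicit Defensive.

Import Order.TTheory GRing.Theory Num.Theory.

Local Open Scope ring_scope.

(** * Forms *)

(** The definition of an SU(2)-structure supplies wedge relations and a sign condition but no
    adapted frame, so the frame is built around the closed form instead of being rotated towards it.
    The horizontal part of the closed form is [- o3 e4] for a horizontal vector [e4], nonzero
    because eta itself is not closed; pairing [e4] with the three 2-forms gives three independent
    functionals, and these cut out the other horizontal vectors. Since SU(2) is simply transitive on
    the unit 1-forms of ker eta, this choice uses up all of it; the later rotation comes from the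
    circle mixing w1 with w2, which the equations treat alike. The number [a] appears because
    nothing makes the closed form vanish on the Reeb vector. *)

Section AltSum.
Variables (R : comNzRingType) (T : Type) (x0 : T).
Implicit Types (F : seq T -> R) (s : seq T).

(** The alternation runs over lists so that it can be peeled one argument at a time; the wedge
    formulas then come out by computation, without listing permutations. *)
Definition altsum n F s : R :=
  \sum_(p : 'S_n) (-1) ^+ p * F [seq nth x0 s (p i) | i <- enum 'I_n].

Lemma altsum0 F s : altsum 0 F s = F [::].
Proof.
rewrite /altsum (big_pred1 1%g) => [|p]; last by apply/esym/eqP/permP; case.
by rewrite odd_perm1 mul1r; case: (enum 'I_0) (size_enum_ord 0).
Qed.

(** As in the cofactor expansion of a determinant, a permutation amounts to its value at [k]
    together with the permutation it induces on the other points. *)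
Lemma sum_lift_perm n (k : 'I_n.+1) (G : 'S_n.+1 -> R) :
  \sum_p G p = \sum_i \sum_(q : 'S_n) G (lift_perm k i q).
Proof.
rewrite (partition_big (fun p : 'S_n.+1 => p k) xpredT) //=.
apply: eq_bigr => i _; rewrite (reindex (lift_perm k i)) /=; last first.
  (* The default [j] is never taken, since [p] is injective and [lift k j] differs from [k]. *)
  pose ulsf k (p : 'S_n.+1) j := odflt j (unlift (p k) (p (lift k j))).
  have ulsfK k' (p : 'S_n.+1) j : lift (p k') (ulsf k' p j) = p (lift k' j).
    rewrite /ulsf; case: unliftP => //= /perm_inj/eqP.
    by rewrite eq_sym (negPf (neq_lift _ _)).
  have inj_ulsf : injective (ulsf k _).
    move=> p; apply: can_inj (ulsf (p k) p^-1%g) _ => j.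
    by rewrite {1}/ulsf ulsfK !permK liftK.
  exists (fun p => perm (inj_ulsf p)) => [p _ | p].
    by apply/permP => j; rewrite permE /ulsf lift_perm_id lift_perm_lift liftK.
  rewrite inE => /eqP pi; apply/permP => j.
  case: (unliftP k j) => [l ->|->]; last by rewrite lift_perm_id.
  by rewrite lift_perm_lift permE -pi ulsfK.
by apply: eq_bigl => p; rewrite lift_perm_id eqxx.
Qed.

Lemma nth_lift n (s : seq T) (i : 'I_n.+1) (j : 'I_n) : size s = n.+1 ->
  nth x0 s (lift i j) = nth x0 (take i s ++ drop i.+1 s) j.
Proof.
move=> sz; rewrite nth_cat size_take sz ltn_ord; case: (ltnP j i) => ji.
  by rewrite nth_take //= /bump leqNgt ji.
by rewrite nth_drop /= /bump ji add1n addSn subnKC.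
Qed.

Lemma altsumS n F s : size s = n.+1 ->
  altsum n.+1 F s = \sum_(i < n.+1) (-1) ^+ i *
    altsum n (fun r => F (nth x0 s i :: r)) (take i s ++ drop i.+1 s).
Proof.
move=> sz; rewrite /altsum (sum_lift_perm ord0); apply: eq_bigr => i _.
rewrite mulr_sumr; apply: eq_bigr => p _.
rewrite odd_lift_perm /= signr_addb signr_odd mulrA; congr (_ * F _).
rewrite enum_ordSl /= lift_perm_id -map_comp; congr cons.
by apply: eq_map => j /=; rewrite lift_perm_lift nth_lift.
Qed.

Lemma altsumSr n F s : size s = n.+1 ->
  altsum n.+1 F s = \sum_(i < n.+1) (-1) ^+ (n + i) *
    altsum n (fun r => F (rcons r (nth x0 s i))) (take i s ++ drop i.+1 s).
Proof.
move=> sz; rewrite /altsum (sum_lift_perm ord_max); apply: eq_bigr => i _.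
rewrite mulr_sumr; apply: eq_bigr => p _.
rewrite odd_lift_perm /= 2!signr_addb !signr_odd -exprD mulrA; congr (_ * F _).
rewrite enum_ordSr map_rcons lift_perm_id -map_comp; congr rcons.
apply: eq_map => j /=; have -> : widen_ord (leqnSn n) j = lift ord_max j.
  by apply: val_inj; rewrite [RHS]lift_max.
by rewrite lift_perm_lift nth_lift.
Qed.

End AltSum.

(** * Explicit values of low-degree wedge products *)

Section FormFormulas.
Variables (F : numFieldType) (V : vectType F).

Lemma wedgeE p q (a : kform V p) (b : kform V q) (t : (p + q).-tuple V) :
  wedge a b t = ((p`! * q`!)%:R)^-1 *
    altsum 0 (p + q) (fun r => a [tuple nth 0 r i | i < p] *
                               b [tuple nth 0 r (p + i)%N | i < q]) t.
Proof.
rewrite /wedge /altsum; congr (_ * _); apply: eq_bigr => s _.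
rewrite -mulrA; congr (_ * (a _ * b _)); apply: eq_from_tnth => i;
  rewrite !tnth_mktuple.
  by rewrite (nth_map (lshift q i)) -?enumT ?size_enum_ord ?ltn_addr //
    (tnth_nth 0) (nth_ord_enum _ (lshift q i)).
by rewrite (nth_map (rshift p i)) -?enumT ?size_enum_ord ?ltn_add2l //
  (tnth_nth 0) (nth_ord_enum _ (rshift p i)).
Qed.

Definition skew_bilinear (w : V -> V -> F) :=
  (forall c x y z, w (c *: x + y) z = c * w x z + w y z) /\
  (forall x y, w x y = - w y x).

Section SkewForm.
Variables (w : V -> V -> F) (skw : skew_bilinear w).

Lemma skewN x y : w x y = - w y x. Proof. exact: skw.2. Qed.

Lemma skew_linr z : linear (w z : V -> F^o).
Proof. by move=> c x y; rewrite skewN skw.1 opprD -mulrN -!skewN. Qed.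

Lemma skewxx x : w x x = 0.
Proof.
by apply/eqP; rewrite -[_ == 0](mulrn_eq0 _ 2) mulr2n {2}skewN subrr.
Qed.

Lemma skewDl x y z : w (x + y) z = w x z + w y z.
Proof. by have := skw.1 1 x y z; rewrite scale1r mul1r. Qed.

Lemma skewDr x y z : w z (x + y) = w z x + w z y.
Proof. by rewrite !(skewN z) skewDl opprD. Qed.

Lemma skew0l z : w 0 z = 0.
Proof. by apply: (addrI (w 0 z)); rewrite -skewDl !addr0. Qed.

Lemma skew0r z : w z 0 = 0. Proof. by rewrite skewN skew0l oppr0. Qed.

Lemma skewZl c x z : w (c *: x) z = c * w x z.
Proof. by rewrite -[c *: x]addr0 skw.1 skew0l addr0. Qed.

Lemma skewZr c x z : w z (c *: x) = c * w z x.
Proof. by rewrite skewN skewZl -mulrN -skewN. Qed.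

End SkewForm.

Lemma altform1_lin (a : kform V 1) : is_altform a ->
  forall c x y, a [tuple c *: x + y] = c * a [tuple x] + a [tuple y].
Proof.
move=> [aL _] c x y; have := aL [tuple x] ord0 c x y.
have E z : tset [tuple x] ord0 z = [tuple z].
  by apply: eq_from_tnth => i; rewrite tnth_mktuple ord1.
by rewrite !E.
Qed.

Lemma altform2_skew (a : kform V 2) :
  is_altform a -> skew_bilinear (fun x y => a [tuple x; y]).
Proof.
move=> [aL a0].
have E0 x y z : tset [tuple x; y] ord0 z = [tuple z; y].
  by apply: eq_from_tnth => i; rewrite tnth_mktuple; case: i => [[|[|]]].
have E1 x y z : tset [tuple x; y] (lift ord0 ord0) z = [tuple x; z].
  by apply: eq_from_tnth => i; rewrite tnth_mktuple; case: i => [[|[|]]].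
have axx x : a [tuple x; x] = 0.
  exact: (a0 [tuple x; x] ord0 (lift ord0 ord0)).
have Ll c x y z : a [tuple c *: x + y; z] = c * a [tuple x; z] + a [tuple y; z].
  by have := aL [tuple x; z] ord0 c x y; rewrite !E0.
split=> // x y; have := axx (1 *: x + y).
have Lr z : a [tuple z; 1 *: x + y] = 1 * a [tuple z; x] + a [tuple z; y].
  by have := aL [tuple z; z] (lift ord0 ord0) 1 x y; rewrite !E1.
rewrite Ll !Lr !mul1r !axx add0r addr0.
by move/eqP; rewrite addr_eq0 => /eqP.
Qed.

Lemma mktuple1 (f : nat -> V) : [tuple f i | i < 1] = [tuple f 0%N].
Proof. by apply: eq_from_tnth => i; rewrite tnth_mktuple ord1. Qed.

Lemma mktuple2 (f : nat -> V) : [tuple f i | i < 2] = [tuple f 0%N; f 1%N].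
Proof. by apply: eq_from_tnth => -[[|[|]]] // i; rewrite tnth_mktuple. Qed.

Lemma mktuple4 (f : nat -> V) :
  [tuple f i | i < 4] = [tuple f 0%N; f 1%N; f 2%N; f 3%N].
Proof.
by apply: eq_from_tnth => -[[|[|[|[|]]]]] // i; rewrite tnth_mktuple.
Qed.

Local Ltac expand_altsum :=
  rewrite wedgeE; do ![rewrite altsumS //= ?big_ord_recl ?big_ord0 /=];
  rewrite !altsum0 ?mktuple1 ?mktuple2 ?mktuple4 /=.

Lemma wedge12E (a : kform V 1) (b : kform V 2) x y z :
  skew_bilinear (fun u v => b [tuple u; v]) ->
  wedge a b [tuple x; y; z] = a [tuple x] * b [tuple y; z]
   - a [tuple y] * b [tuple x; z] + a [tuple z] * b [tuple x; y].
Proof.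
move=> /skewN bN; expand_altsum.
rewrite (bN z y) (bN z x) (bN y x) (_ : 1`! = 1)%N // (_ : 2`! = 2)%N //.
by field.
Qed.

Lemma wedge22E (a b : kform V 2) x y z u :
  skew_bilinear (fun u v => a [tuple u; v]) ->
    skew_bilinear (fun u v => b [tuple u; v]) ->
  wedge a b [tuple x; y; z; u] =
    a [tuple x; y] * b [tuple z; u] - a [tuple x; z] * b [tuple y; u]
  + a [tuple x; u] * b [tuple y; z] + a [tuple y; z] * b [tuple x; u]
  - a [tuple y; u] * b [tuple x; z] + a [tuple z; u] * b [tuple x; y].
Proof.
move=> /skewN aN /skewN bN; expand_altsum.
rewrite (aN z y) (aN z x) (aN y x) (aN u x) (aN u y) (aN u z).
rewrite (bN z y) (bN z x) (bN y x) (bN u x) (bN u y) (bN u z).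
rewrite (_ : 2`! = 2)%N //.
by field.
Qed.

Lemma wedge41E (v : kform V 4) (a : kform V 1) (w : V -> V -> F)
    x1 x2 x3 x4 x5 :
  let P x y z u := 2 * (w x y * w z u - w x z * w y u + w x u * w y z) in
  skew_bilinear w -> (forall x y z u, v [tuple x; y; z; u] = P x y z u) ->
  wedge v a [tuple x1; x2; x3; x4; x5] =
    P x2 x3 x4 x5 * a [tuple x1] - P x1 x3 x4 x5 * a [tuple x2]
  + P x1 x2 x4 x5 * a [tuple x3] - P x1 x2 x3 x5 * a [tuple x4]
  + P x1 x2 x3 x4 * a [tuple x5].
Proof.
move=> P /skewN wN vE.
(* [v] is already alternating, so all 24 permutations contribute the same value. Expanding along the
   last argument isolates the 1-form and leaves exactly these sums. *)
have v24 x y z u c : altsum 0 4 (fun r =>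
      v [tuple nth 0 (rcons r c) i | i < 4] *
      a [tuple nth 0 (rcons r c) (4 + i)%N | i < 1]) [:: x; y; z; u] =
    24 * P x y z u * a [tuple c].
  do ![rewrite altsumS //= ?big_ord_recl ?big_ord0 /=].
  rewrite !altsum0 ?mktuple1 ?mktuple4 /= !vE /P.
  rewrite (wN y x) (wN z x) (wN u x) (wN z y) (wN u y) (wN u z).
  by ring.
rewrite wedgeE altsumSr //= !big_ord_recl big_ord0 /= !v24.
rewrite (_ : 1`! = 1)%N // (_ : 4`! = 24)%N //.
by field.
Qed.

End FormFormulas.

Section CE.
Variables (F : numFieldType) (g : lieAlgType F).

Lemma CEd1E (a : kform g 1) x y : CEd a [tuple x; y] = - a [tuple lie x y].
Proof.
rewrite /CEd; do ![rewrite !big_mkcond /= ?big_ord_recl ?big_ord0 /=].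
rewrite !add0r !addr0 mulN1r; congr (- a _); apply: val_inj => /=.
by case: (enum 'I_0) (size_enum_ord 0).
Qed.

Lemma CEd3E (a : kform g 3) x y z u :
  CEd a [tuple x; y; z; u] =
  - a [tuple lie x y; z; u] + a [tuple lie x z; y; u]
  - a [tuple lie x u; y; z] - a [tuple lie y z; x; u]
  + a [tuple lie y u; x; z] - a [tuple lie z u; x; y].
Proof.
rewrite /CEd; do ![rewrite !big_mkcond /= ?big_ord_recl ?big_ord0 /=].
have E p q f : a [tuple of lie p q :: [tuple f l | l < 2]] =
   a [tuple lie p q; f ord0; f (lift ord0 ord0)].
  congr a; apply: val_inj; rewrite /= !enum_ordSl /=.
  by case: (enum 'I_0) (size_enum_ord 0).
rewrite !E !(tnth_nth 0) /=.
ring.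
Qed.
End CE.

(** * Solvability *)

(** Solvability makes the derived algebra a proper subspace; a coordinate of the projection to a
    complement is the required form. *)
Lemma solvable_annihilator (F : fieldType) (g : lieAlgType F) :
  (0 < \dim {:g})%N -> lie_solvable g ->
  exists a : g -> F, [/\ linear (a : g -> F^o), exists x, a x != 0
    & forall x y, a (lie x y) = 0].
Proof.
move=> dim_gt0 [n solv]; pose W := derived {:g}%VS.
have W_lie x y : lie x y \in W.
  by apply: (derivedP {:g} W).2; rewrite ?subvv ?memvf.
have : (W^C)%VS != 0%VS.
  apply: contraTneq dim_gt0 => WC0.
  have WT : W = fullv.
    by apply/eqP; rewrite eqEsubv subvf -(addv_complf W) WC0 addv0 subvv.
  have iterT : iter n (@derived F g) fullv = fullv.
    by elim: n {solv} => //= n ->; exact: WT.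
  by rewrite -iterT solv dimv0.
rewrite -dimv_eq0 -lt0n => WC_gt0; pose i := Ordinal WC_gt0.
pose P := daddv_pi (W^C)%VS W.
have dWC : ((W^C) :&: W = 0)%VS by rewrite capvC capv_compl.
pose a x := coord (vbasis (W^C)) i (P x).
exists a; split.
- by move=> c x y; rewrite /a !linearP.
- exists (vbasis (W^C))`_i; rewrite /a daddv_pi_id //; last first.
    by apply: vbasis_mem; rewrite mem_nth ?size_tuple.
  by rewrite coord_free ?eqxx ?oner_eq0 // (basis_free (vbasisP _)).
- move=> x y; rewrite /a (_ : P _ = 0) ?linear0 //.
  have dW : (W :&: W^C = 0)%VS by exact: capv_compl.
  have := daddv_pi_add dWC (_ : lie x y \in (W^C + W)%VS).
  rewrite addvC addv_complf memvf => /(_ isT).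
  rewrite (daddv_pi_id dW (W_lie x y)) => /(congr1 (fun u => u - lie x y)).
  by rewrite addrK subrr.
Qed.

(* The three equations define a quotient of g, a form of sl(2), which equals
   its own derived algebra. *)
Lemma perfect_quotient_not_solvable (F : numFieldType) (g : lieAlgType F)
    (p q r : g -> F) (T C G : F) :
  linear (p : g -> F^o) -> linear (q : g -> F^o) -> linear (r : g -> F^o) ->
  T != 0 -> C ^+ 2 + G ^+ 2 != 0 ->
  (forall x y, p (lie x y) = - T * (q x * r y - q y * r x)) ->
  (forall x y, q (lie x y) = C * (p x * q y - p y * q x) +
    G * (p x * r y - p y * r x)) ->
  (forall x y, r (lie x y) = G * (p x * q y - p y * q x) -
    C * (p x * r y - p y * r x)) ->
  (forall c1 c2 c3, exists x, [/\ p x = c1, q x = c2 & r x = c3]) ->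
  ~ lie_solvable g.
Proof.
move=> lp lq lr T0 CG0 pE qE rE surj [n solv].
have scal (f : g -> F) c x : linear (f : g -> F^o) -> f (c *: x) = c * f x.
  move=> lf; have f0 : f 0 = 0.
    by have := lf (-1) 0 0; rewrite scaler0 addr0 [_ *: _]mulN1r addNr.
  by rewrite -[c *: x]addr0 lf f0 addr0.
(* The triple [(p, q, r)] stays surjective on every derived algebra, so none of them is zero. *)
have {surj} H m : forall c1 c2 c3, exists x,
    x \in iter m (@derived F g) fullv /\ [/\ p x = c1, q x = c2 & r x = c3].
  elim: m => [|m IH] c1 c2 c3.
    by have [x Hx] := surj c1 c2 c3; exists x; rewrite memvf.
  have [x [Ux [px qx rx]]] := IH 1 0 0.
  have [y [Uy [py qy ry]]] := IH 0 1 0.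
  have [z [Uz [pz qz rz]]] := IH 0 0 1.
  have mem := (derivedP _ _).2 (subvv (derived (iter m (@derived F g) fullv))).
  (* The brackets [lie y z], [lie x y], [lie x z] have values [(- T, 0, 0)], [(0, C, G)],
     [(0, G, - C)]; the coefficients invert this system, whose lower block has determinant
     [- (C ^+ 2 + G ^+ 2)]. *)
  exists ((- c1 / T) *: lie y z
    + (((C * c2 + G * c3) / (C ^+ 2 + G ^+ 2)) *: lie x y
    + ((G * c2 - C * c3) / (C ^+ 2 + G ^+ 2)) *: lie x z)); split.
    by apply: memvD; last apply: memvD; apply: memvZ; exact: mem.
  rewrite lp lp scal // lq lq scal // lr lr scal //
    !(pE, qE, rE) px qx rx py qy ry pz qz rz.
  rewrite /GRing.scale /=.
  by split; field; rewrite ?T0 ?CG0.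
have [x [+ [px _ _]]] := H n 1 0 0.
rewrite solv memv0 => /eqP x0; move: px;
  rewrite x0 -(scale0r x) scal // mul0r => /eqP.
by rewrite eq_sym oner_eq0.
Qed.

(** * Structure equations and their classification *)

Section Models.
Variable R : realType.
Implicit Types (x y z : 'rV[R]_5) (br : 'rV[R]_5 -> 'rV[R]_5 -> 'rV[R]_5).

Definition co x (k : nat) : R := x 0 (inord k).
Definition row5 (s : seq R) : 'rV[R]_5 := \row_j s`_j.

Lemma co_row5 s k : (k < 5)%N -> co (row5 s) k = s`_k.
Proof. by move=> k5; rewrite /co mxE inordK. Qed.

Lemma co_inj x y : (forall k, (k < 5)%N -> co x k = co y k) -> x = y.
Proof.
by move=> E; apply/rowP => j; have := E j (ltn_ord j); rewrite /co inord_val.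
Qed.

Lemma coD x y k : co (x + y) k = co x k + co y k.
Proof. by rewrite /co mxE. Qed.

Lemma coZ c x k : co (c *: x) k = c * co x k.
Proof. by rewrite /co mxE. Qed.

Lemma coN x k : co (- x) k = - co x k.
Proof. by rewrite /co mxE. Qed.

Lemma co0 k : co 0 k = 0.
Proof. by rewrite /co mxE. Qed.

Lemma coX i k : (i.-1 < 5)%N -> (k < 5)%N -> co (X R i) k = (k == i.-1)%:R.
Proof. by move=> i5 k5; rewrite /co mxE eqxx -(inj_eq val_inj) /= !inordK. Qed.

Lemma co_table (T : table R) x y k : co (table_lie T x y) k =
  foldr (fun e s => (co x e.1.1.-1 * co y e.1.2.-1
    - co x e.1.2.-1 * co y e.1.1.-1) * co e.2 k + s) 0 T.
Proof.
rewrite /co /table_lie summxE; elim: T => [|e T IH]; first by rewrite big_nil.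
by rewrite big_cons IH /= mxE.
Qed.

(** [br] is a bare function with no Jacobi identity attached. The identity is inherited from [g], so
    it can be read as a system of equations on free structure constants. *)
Definition modelled (g : lieAlgType R) br := exists e : g -> 'rV[R]_5,
  [/\ linear e, bijective e & forall u v, e (lie u v) = br (e u) (e v)].

Lemma modelled_jacobi g br : modelled g br -> forall x y z,
  br x (br y z) + br y (br z x) + br z (br x y) = 0.
Proof.
move=> [e [el [e' eK e'K] eB]] x y z; rewrite -(e'K x) -(e'K y) -(e'K z) -!eB.
have eD u v : e (u + v) = e u + e v by rewrite -[u]scale1r el !scale1r.
rewrite -!eD lie_jacobi; apply: (addrI (e 0)); by rewrite -eD !addr0.
Qed.

Lemma modelled_change g br br' (L L' : 'rV[R]_5 -> 'rV[R]_5) :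
  linear L -> cancel L L' -> cancel L' L ->
  (forall x y, L (br x y) = br' (L x) (L y)) ->
  modelled g br <-> modelled g br'.
Proof.
move=> Ll LK L'K LB; split=> -[e [el eb eB]].
  exists (L \o e); split.
  - by move=> c u v /=; rewrite el Ll.
  - by apply: bij_comp eb; exists L'.
  - by move=> u v /=; rewrite eB LB.
exists (L' \o e); split.
- by move=> c u v; apply: (can_inj LK); rewrite Ll /= !L'K el.
- by apply: bij_comp eb; exists L.
- by move=> u v; apply: (can_inj LK); rewrite LB /= !L'K.
Qed.

Lemma modelled_iso g (T : table R) (JT : jacobi T) :
  lie_isomorphic g (table_alg JT) <-> modelled g (table_lie T).
Proof.
split=> [[f [fb fB]] | [e [el eb eB]]].
  by exists f; split=> //; exact: linearP.
pose f : {linear g -> table_alg JT} :=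
  HB.pack (e : g -> table_alg JT)
    (GRing.isLinear.Build R g (table_alg JT) _ _ el).
by exists f; split.
Qed.

End Models.

Arguments co {R}.
Arguments row5 {R}.

(* The bracket dual to the coframe equations, writing m i j for e^ij(x, y):
   the general solution of the conditions that are linear in the structure
   constants (d eta = -2 w3, d w3 = 0, d(eta ^ w1) = d(eta ^ w2) = 0) when
   e^1 + a e^5 is closed.  On ker eta it is a torsion-free connection with
   values in the anti-self-dual copy of su(2), whose free part is the
   symmetric matrix [A B C; B D E; C E G]; the other parameters are the
   entries of the bracket with the Reeb vector, an element of sp(4). *)
HB.lock Definition hbr (R : realType)
    (a A B C D E G x1 x2 x3 y1 y2 z1 : R) (x y : 'rV[R]_5) : 'rV[R]_5 :=
  let m i j := co x i.-1 * co y j.-1 - co x j.-1 * co y i.-1 in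
  row5 [:: - (2 * a * (m 1 4 + m 2 3));
    A * m 1 2 + (3 * a + B) * m 1 3 + C * m 1 4 - x1 * m 1 5 - C * m 2 3
    - (a - B) * m 2 4 - x2 * m 2 5 + (D + G) * m 3 4 - x3 * m 3 5;
    - (3 * a - B) * m 1 2 + D * m 1 3 + E * m 1 4 - y1 * m 1 5 - E * m 2 3
    - (A + G) * m 2 4 - y2 * m 2 5 - (a + B) * m 3 4 + x2 * m 3 5;
    C * m 1 2 + E * m 1 3 + G * m 1 4 - z1 * m 1 5 + (A + D) * m 2 3
    + E * m 2 4 - y1 * m 2 5 - C * m 3 4 + x1 * m 3 5;
    2 * (m 1 4 + m 2 3)].

Arguments hbr {R}.

Section Classification.
Variable R : realType.

Lemma hbr_row5 (a A B C D E G x1 x2 x3 y1 y2 z1 : R)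
    (s1 s2 s3 s4 s5 t1 t2 t3 t4 t5 : R) :
  let m12 := s1 * t2 - s2 * t1 in let m13 := s1 * t3 - s3 * t1 in
  let m14 := s1 * t4 - s4 * t1 in let m15 := s1 * t5 - s5 * t1 in
  let m23 := s2 * t3 - s3 * t2 in let m24 := s2 * t4 - s4 * t2 in
  let m25 := s2 * t5 - s5 * t2 in let m34 := s3 * t4 - s4 * t3 in
  let m35 := s3 * t5 - s5 * t3 in
  hbr a A B C D E G x1 x2 x3 y1 y2 z1
    (row5 [:: s1; s2; s3; s4; s5]) (row5 [:: t1; t2; t3; t4; t5]) =
  row5 [:: - (2 * a * (m14 + m23));
    A * m12 + (3 * a + B) * m13 + C * m14 - x1 * m15 - C * m23
    - (a - B) * m24 - x2 * m25 + (D + G) * m34 - x3 * m35;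
    - (3 * a - B) * m12 + D * m13 + E * m14 - y1 * m15 - E * m23
    - (A + G) * m24 - y2 * m25 - (a + B) * m34 + x2 * m35;
    C * m12 + E * m13 + G * m14 - z1 * m15 + (A + D) * m23
    + E * m24 - y1 * m25 - C * m34 + x1 * m35;
    2 * (m14 + m23)].
Proof. by rewrite hbr.unlock /= !co_row5. Qed.

Lemma row5_sum3 k (s t r : seq R) : (k < 5)%N ->
  row5 s + row5 t + row5 r = 0 -> s`_k + t`_k + r`_k = 0.
Proof. by move=> k5 /(congr1 (co^~ k)); rewrite !coD co0 !co_row5. Qed.

(* Each use is one coordinate, counted from 1, of the Jacobi identity on three basis vectors. The
   wanted equation may be that coordinate or its opposite, so both signs are tried. *)
Local Tactic Notation "jac" constr(M) constr(i) constr(j) constr(k) constr(l) :=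
  let J := fresh in
  have := modelled_jacobi M i j k;
  rewrite !hbr_row5 => /(@row5_sum3 l.-1 _ _ _ isT) J; simpl in J;
  first [rewrite -[RHS]J; ring | rewrite -[RHS]oppr0 -[in RHS]J; ring].

Local Notation b1 := (@row5 R [:: 1; 0; 0; 0; 0]).
Local Notation b2 := (@row5 R [:: 0; 1; 0; 0; 0]).
Local Notation b3 := (@row5 R [:: 0; 0; 1; 0; 0]).
Local Notation b4 := (@row5 R [:: 0; 0; 0; 1; 0]).
Local Notation b5 := (@row5 R [:: 0; 0; 0; 0; 1]).

Section Jacobi.
Variables (g : lieAlgType R) (a A B C D E G x1 x2 x3 y1 y2 z1 : R).
Hypothesis M : modelled g (hbr a A B C D E G x1 x2 x3 y1 y2 z1).

Lemma hbr_aC : 4 * C * a = 0. Proof. jac M b2 b3 b4 2%N. Qed.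
Lemma hbr_aE : 4 * E * a = 0. Proof. jac M b2 b3 b4 3%N. Qed.
Lemma hbr_y1 : 2 * y1 - 4 * a * C - 3 * A * E + 2 * (B + a) * C - D * E - E
  * G = 0.
Proof. jac M b1 b2 b3 3%N. Qed.
Lemma hbr_Cy1 : 2 * (a * z1 - C * y1 + E * x1) = 0.
Proof. jac M b1 b4 b5 4%N. Qed.
End Jacobi.

Local Ltac linear_row5_tac :=
  let c := fresh in let u := fresh in let v := fresh in
  move=> c u v; apply: co_inj => -[|[|[|[|[|?]]]]] // _;
  rewrite !(coD, coZ) !co_row5 //= ?(coD, coZ); ring.

Local Ltac cancel_row5_tac :=
  let u := fresh in
  move=> u; apply: co_inj => -[|[|[|[|[|?]]]]] // _;
    rewrite !co_row5 //= ?co_row5 //=.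

Lemma co_hbr (a A B C D E G x1 x2 x3 y1 y2 z1 : R) u v k : (k < 5)%N ->
  co (hbr a A B C D E G x1 x2 x3 y1 y2 z1 u v) k =
  let m i j := co u i.-1 * co v j.-1 - co u j.-1 * co v i.-1 in
  [:: - (2 * a * (m 1 4 + m 2 3));
    A * m 1 2 + (3 * a + B) * m 1 3 + C * m 1 4 - x1 * m 1 5 - C * m 2 3
    - (a - B) * m 2 4 - x2 * m 2 5 + (D + G) * m 3 4 - x3 * m 3 5;
    - (3 * a - B) * m 1 2 + D * m 1 3 + E * m 1 4 - y1 * m 1 5 - E * m 2 3
    - (A + G) * m 2 4 - y2 * m 2 5 - (a + B) * m 3 4 + x2 * m 3 5;
    C * m 1 2 + E * m 1 3 + G * m 1 4 - z1 * m 1 5 + (A + D) * m 2 3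
    + E * m 2 4 - y1 * m 2 5 - C * m 3 4 + x1 * m 3 5;
    2 * (m 1 4 + m 2 3)]`_k.
Proof. by move=> k5; rewrite hbr.unlock co_row5. Qed.

(* Rotating e^2, e^3 (and w1, w2 accordingly) preserves the hypo-contact
   conditions and acts on the symmetric matrix by conjugation. *)
Lemma hbr_rotate g (c s a A B C D E G x1 x2 x3 y1 y2 z1 : R) :
  c ^+ 2 + s ^+ 2 = 1 ->
  modelled g (hbr a A B C D E G x1 x2 x3 y1 y2 z1) ->
  modelled g (hbr a
    (c ^+ 2 * A + 2 * c * s * B + s ^+ 2 * D)
    ((c ^+ 2 - s ^+ 2) * B - c * s * (A - D)) (c * C + s * E)
    (s ^+ 2 * A - 2 * c * s * B + c ^+ 2 * D) (c * E - s * C) G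
    (c * x1 + s * y1) ((c ^+ 2 - s ^+ 2) * x2 + c * s * (x3 + y2))
    (c ^+ 2 * x3 - s ^+ 2 * y2 - 2 * c * s * x2)
    (c * y1 - s * x1) (c ^+ 2 * y2 - s ^+ 2 * x3 - 2 * c * s * x2) z1).
Proof.
move=> cs1; have cc : c ^+ 2 = 1 - s ^+ 2 by rewrite -cs1 addrK.
apply: (iffLR (@modelled_change _ g _ _
  (fun u => row5 [:: co u 0; c * co u 1 + s * co u 2; c * co u 2 - s * co u 1;
    co u 3; co u 4])
  (fun u => row5 [:: co u 0; c * co u 1 - s * co u 2; c * co u 2 + s * co u 1;
    co u 3; co u 4]) _ _ _ _)).
- linear_row5_tac.
- by cancel_row5_tac; ring: cc.
- by cancel_row5_tac; ring: cc.
- move=> u v; apply: co_inj => -[|[|[|[|[|?]]]]] // _;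
  by rewrite co_row5 // !co_hbr //= !co_row5 //=; ring: cc.
Qed.

(** * Identification of the normal forms with the five tables *)

Local Ltac iso_tac :=
  let u := fresh in let v := fresh in
  move=> u v; apply: co_inj => -[|[|[|[|[|?]]]]] // _;
  rewrite co_table ?co_row5 // !co_hbr //= !co_row5 //= ?coZ ?coN ?coX //=.

Lemma hbr_h1 g : modelled g (hbr (0:R) 0 0 0 0 0 0 0 0 0 0 0 0) <->
  lie_isomorphic g (h1 R).
Proof.
apply: iff_trans (iff_sym (modelled_iso _ _)); apply: (@modelled_change _ g _ _
  (fun u => row5 [:: co u 0; co u 1; co u 2; co u 3; co u 4 / 2])
  (fun u => row5 [:: co u 0; co u 1; co u 2; co u 3; co u 4 * 2])).
- linear_row5_tac.
- by cancel_row5_tac; field.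
- by cancel_row5_tac; field.
- by iso_tac; field.
Qed.

(** The vector dual to e^1 acts on the span of e^4 and e^5 with eigenforms e^4 + (3A/2) e^5 and e^4
    - A e^5, of weights in ratio 2 : -3; these give the coordinates along X_1 and X_4. The factor
    [5 * A] is the coefficient of e^23 in the bracket component of the first. *)
Lemma hbr_h2 g (A : R) : A != 0 ->
  modelled g (hbr 0 A 0 0 A 0 (- A) 0 0 0 0 0 (- 3 * A ^+ 2)) <->
  lie_isomorphic g (h2 R).
Proof.
move=> A0; apply: iff_trans (iff_sym (modelled_iso _ _)).
apply: (@modelled_change _ g _ _
  (fun u => row5 [:: (co u 3 + 3 * A / 2 * co u 4) / (5 * A); co u 1; co u 2;
     co u 3 - A * co u 4; - A * co u 0])
  (fun u => row5 [:: - co u 4 / A; co u 1; co u 2;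
     co u 3 + A * (2 * co u 0 - 2 * co u 3 / (5 * A));
       2 * co u 0 - 2 * co u 3 / (5 * A)])).
- linear_row5_tac.
- by cancel_row5_tac; field.
- by cancel_row5_tac; field.
- by iso_tac; field.
Qed.

(** The closed forms A e^1 + a e^4 and a e^1 - A e^4 + (A^2 + a^2) e^5 become, up to scale, the
    coordinates along X_4 and X_5. *)
Lemma hbr_h3 g (a A : R) : A ^+ 2 + a ^+ 2 != 0 ->
  modelled g (hbr a A 0 0 A 0 (2 * A) 0 0 (3 * (A ^+ 2 + a ^+ 2)) 0
    (- 3 * (A ^+ 2 + a ^+ 2)) 0) <->
  lie_isomorphic g (h3 R).
Proof.
move=> n0; apply: iff_trans (iff_sym (modelled_iso _ _)).
apply: (@modelled_change _ g _ _
  (fun u => row5 [:: - (a * co u 0 - A * co u 3) / (2 * (A ^+ 2 + a ^+ 2));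
     co u 1; co u 2; - (A * co u 0 + a * co u 3);
     - (3 * a * co u 0 - 3 * A * co u 3 + 3 * (A ^+ 2 + a ^+ 2) * co u 4)])
  (fun u => row5 [:: - 2 * a * co u 0 - A * co u 3 / (A ^+ 2 + a ^+ 2); co u 1;
    co u 2;
     2 * A * co u 0 - a * co u 3 / (A ^+ 2 + a ^+ 2);
     2 * co u 0 - co u 4 / (3 * (A ^+ 2 + a ^+ 2))])).
- linear_row5_tac.
- by cancel_row5_tac; field.
- by cancel_row5_tac; field.
- by iso_tac; field.
Qed.

(** As for [h2], but the eigenforms e^4 + (A/2) e^5 and e^4 - (A/2) e^5 have opposite weights; they
    give the coordinates along X_1 and X_3. *)
Lemma hbr_h5 g (A : R) : A != 0 ->
  modelled g (hbr 0 A 0 0 0 0 0 0 0 0 0 (- (A ^+ 2 / 2)) (- (A ^+ 2 / 2))) <->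
  lie_isomorphic g (h5 R).
Proof.
move=> A0; apply: iff_trans (iff_sym (modelled_iso _ _)).
apply: (@modelled_change _ g _ _
  (fun u => row5 [:: - (co u 3 + A / 2 * co u 4) / (2 * A ^+ 2); co u 2 / A;
     co u 3 - A / 2 * co u 4; co u 1; - A * co u 0])
  (fun u => row5 [:: - co u 4 / A; co u 3; A * co u 1;
     (co u 2 - 2 * A ^+ 2 * co u 0) / 2;
       - (2 * A ^+ 2 * co u 0 + co u 2) / A])).
- linear_row5_tac.
- by cancel_row5_tac; field.
- by cancel_row5_tac; field.
- by iso_tac; field.
Qed.

(** The matrix is [A 0 C; 0 0 0; C 0 G], with the Reeb entries that the Jacobi identity forces. The
    next notation is its subfamily of trace zero. *)
Local Notation hbr_edge A C G := (hbr 0 A 0 C 0 0 G (C * (A + G) / 2) 0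
  ((G ^+ 2 - A * G) / 2 + C ^+ 2) 0 (- ((A + G) ^+ 2 / 2))
  (- ((A ^+ 2 - A * G) / 2 + C ^+ 2))).
Local Notation hbr_traceless_br C G := (hbr 0 (- G) 0 C 0 0 G 0 0
  (G ^+ 2 + C ^+ 2) 0 0 (- (G ^+ 2 + C ^+ 2))).

(* The two closed forms act diagonally on the commuting forms
   m e2 - l e4 + (G^2 + C^2) e5 with weight l e1 + m e3; the three weights are
   the solutions (l, m) of z^2 = -2 (G - i C) conj(z) for z = l + i m, and they
   differ by rotations of 120 degrees, hence the sqrt 3. *)
Lemma hbr_h4_weights g (C G l m : R) : G ^+ 2 + C ^+ 2 != 0 ->
  l * m = G * m + C * l -> l ^+ 2 = 2 * (G ^+ 2 + C ^+ 2) + C * m - G * l ->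
  m ^+ 2 = 2 * (G ^+ 2 + C ^+ 2) - C * m + G * l ->
  modelled g (hbr_traceless_br C G) <->
  lie_isomorphic g (h4 R).
Proof.
move=> K0 lm ll mm; pose t : R := Num.sqrt 3.
have tt : t ^+ 2 = 3 by rewrite sqr_sqrtr.
have t0 : t != 0 by rewrite sqrtr_eq0 -ltNge ltr0n.
apply: iff_trans (iff_sym (modelled_iso _ _)); apply: (@modelled_change _ g _ _
  (fun u =>
     let l2 := - (l + t * m) / 2 in let m2 := (t * l - m) / 2 in
     let l3 := (t * m - l) / 2 in let m3 := - (t * l + m) / 2 in
     let K := G ^+ 2 + C ^+ 2 in
     row5 [:: m * co u 1 - l * co u 3 + K * co u 4;
     m2 * co u 1 - l2 * co u 3 + K * co u 4;
     m3 * co u 1 - l3 * co u 3 + K * co u 4;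
     l * co u 0 + m * co u 2; l2 * co u 0 + m2 * co u 2])
  (fun u => let l2 := - (l + t * m) / 2 in let m2 := (t * l - m) / 2 in
     let K := G ^+ 2 + C ^+ 2 in
     (* [d] is the determinant [l * m2 - l2 * m], because [l ^+ 2 + m ^+ 2 = 4 * K]. The three
        weights add up to zero, so the first three coordinates add up to [3 * K] times the fifth. *)
     let d := 2 * t * K in
     let x5 := (co u 0 + co u 1 + co u 2) / (3 * K) in
     let p1 := co u 0 - K * x5 in let p2 := co u 1 - K * x5 in
     row5 [:: (m2 * co u 3 - m * co u 4) / d; (l * p2 - l2 * p1) / d;
       (l * co u 4 - l2 * co u 3) / d; (m * p2 - m2 * p1) / d; x5])).
- linear_row5_tac.
- by cancel_row5_tac; field: ll mm lm tt; rewrite ?K0 ?t0.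
- by cancel_row5_tac; field: ll mm lm tt; rewrite ?K0 ?t0.
- by iso_tac; field: ll mm lm tt.
Qed.

(** The first equation gives [m = C * l / (l - G)], and elimination leaves the cubic [p]. Its values
    [2 * G * (G ^+ 2 + C ^+ 2)] at 0 and [- G * C ^+ 2] at [G] have opposite signs, and the second
    also shows that the root is not [G]. *)
Lemma cubic_weights (G C : R) : G ^+ 2 + C ^+ 2 != 0 -> exists l m,
  [/\ l * m = G * m + C * l, l ^+ 2 = 2 * (G ^+ 2 + C ^+ 2) + C * m - G * l
    & m ^+ 2 = 2 * (G ^+ 2 + C ^+ 2) - C * m + G * l].
Proof.
have [-> | C0 K0] := eqVneq C 0.
  by move=> _; exists (- 2 * G), 0; split; ring.
have [-> | G0] := eqVneq G 0; first by exists 0, (- 2 * C); split; ring.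
pose p : {poly R} := 'X ^+ 3 - (3 * (G ^+ 2 + C ^+ 2)) *:
  'X + (2 * G * (G ^+ 2 + C ^+ 2))%:P.
have pE x : p.[x] = x ^+ 3 - 3 * (G ^+ 2 + C ^+ 2) * x + 2 * G
  * (G ^+ 2 + C ^+ 2).
  by rewrite !hornerE.
have [l pl] : exists l, root p l.
  have p0 : p.[0] = 2 * G * (G ^+ 2 + C ^+ 2) by rewrite pE; ring.
  have pG : p.[G] = - G * C ^+ 2 by rewrite pE; ring.
  have C2 : 0 < C ^+ 2 by rewrite exprn_even_gt0.
  have G2 : 0 < G ^+ 2 by rewrite exprn_even_gt0.
  have [Gp | Gn] := ltP 0 G.
    have [||x _ px] := @poly_ivt R (- p) 0 G; first exact: ltW.
      by rewrite !hornerN p0 pG; apply/andP; split; nra.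
    by exists x; rewrite rootN in px.
  have {G0}Gn : G < 0 by rewrite lt_neqAle G0.
  have [||x _ px] := @poly_ivt R (- p) G 0; first exact: ltW.
    by rewrite !hornerN p0 pG; apply/andP; split; nra.
  by exists x; rewrite rootN in px.
have := pl; rewrite /root pE => /eqP lE.
have lG : l - G != 0.
  apply: contra C0 => /eqP/subr0_eq lGE; move: lE; rewrite lGE => e.
  have {e} : - G * C ^+ 2 = 0 by rewrite -[RHS]e; ring.
  by move/eqP; rewrite mulf_eq0 oppr_eq0 (negPf G0) expf_eq0.
exists l, (C * l / (l - G)); split; first by field.
  by apply: (mulfI lG); rewrite -[LHS]subr0 -lE; field.
by apply: (mulfI (expf_neq0 2 lG)); rewrite -[LHS]subr0 -(mulr0 (- G)) -lE;
  field.
Qed.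

Lemma hbr_h4 g (C G : R) : G ^+ 2 + C ^+ 2 != 0 ->
  modelled g (hbr_traceless_br C G) <->
  lie_isomorphic g (h4 R).
Proof.
by move=> K0; have [l [m [lm ll mm]]] := cubic_weights K0;
  exact: (hbr_h4_weights _ K0 lm ll mm).
Qed.

(** Cancelling [a] from the Jacobi components gives [G = A + D]; then [A - D] annihilates both
    [A + D] and [A + 2 * D], which forces [A = D]. *)
Lemma hbr_diag_ne0 g (a A D G x1 x2 x3 y1 y2 z1 : R) : a != 0 ->
  modelled g (hbr a A 0 0 D 0 G x1 x2 x3 y1 y2 z1) -> lie_isomorphic g (h3 R).
Proof.
move=> a0 M.
have e1 : 2 * x1 = 0 by jac M b1 b2 b3 2%N.
have e2 : 2 * y1 = 0 by jac M b1 b2 b3 3%N.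
have e3 : 2 * a * z1 = 0 by jac M b1 b4 b5 4%N.
have e4 : 2 * a * (A + D - G) = 0 by jac M b2 b3 b4 4%N.
have e5 : -2 * x2 + 5 * A * a - 3 * D * a - G * a = 0 by jac M b1 b2 b4 2%N.
have e6 : -2 * x3 -A*D -A*G +D*D +2*D*G +G*G +6*a*a = 0 by jac M b1 b3 b4 2%N.
have e7 : - 2*y2 -A*A +A*D -2*A*G +D*G -G*G -6*a*a = 0 by jac M b1 b2 b4 3%N.
have e8 : -3 * a * x3 - 3 * a * y2 + a * z1 = 0 by jac M b1 b3 b5 3%N.
have e9 : -2 * D * x2 - 2 * G * x2 = 0 by jac M b3 b4 b5 2%N.
have z0 : z1 = 0.
  by apply/eqP; move/eqP: e3; rewrite -mulrA mulf_eq0 pnatr_eq0 mulf_eq0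
    (negPf a0).
have {e4} GE : G = A + D.
  apply/esym/subr0_eq/eqP; move/eqP: e4.
  by rewrite -mulrA mulf_eq0 pnatr_eq0 mulf_eq0 (negPf a0).
have x1E : x1 = 0 by lra.
have y1E : y1 = 0 by lra.
subst G z1 x1 y1.
have x2E : x2 = 2 * a * (A - D) by lra.
have x3E : x3 = A * D + 2 * D ^+ 2 + 3 * a ^+ 2 by lra.
have y2E : y2 = - (2 * A ^+ 2 + A * D + 3 * a ^+ 2) by lra.
subst x2 x3 y2.
have AD : (A - D) * (A + D) = 0.
  by apply: (mulfI (_ : 6 * a != 0));
    rewrite ?mulf_neq0 ?pnatr_eq0 // mulr0 -[RHS]e8; ring.
have {}e9 : (A - D) * (A + 2 * D) = 0.
  by apply: (mulfI (_ : - 4 * a != 0));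
    rewrite ?mulf_neq0 ?oppr_eq0 ?pnatr_eq0 // mulr0 -[RHS]e9; ring.
have DA : D = A.
  apply/eqP; apply: contraT; rewrite eq_sym -subr_eq0 => nAD.
  have p : A + D = 0 by apply: (mulfI nAD); rewrite mulr0.
  have q : A + 2 * D = 0 by apply: (mulfI nAD); rewrite mulr0.
  by move: nAD; rewrite (_ : A - D = 0) ?eqxx //; lra.
subst D; have n0 : A ^+ 2 + a ^+ 2 != 0.
  by rewrite gt_eqF // ltr_wpDl ?sqr_ge0 // exprn_even_gt0.
apply/(hbr_h3 _ n0); move: M; congr
  (modelled g (hbr _ _ _ _ _ _ _ _ _ _ _ _ _)); ring.
Qed.

(** The Jacobi components on horizontal triples are linear in the Reeb entries and determine them;
    those on triples containing the Reeb vector [b5] then become the three cubics. *)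
Lemma hbr_diag0 g (A D G x1 x2 x3 y1 y2 z1 : R) :
  modelled g (hbr 0 A 0 0 D 0 G x1 x2 x3 y1 y2 z1) ->
  [/\ D * (D + G) * (2 * A - G) = 0, A * (A + G) * (2 * D - G) = 0,
      (A + G) * (D + G) * (D - A) = 0
    & modelled g (hbr 0 A 0 0 D 0 G 0 0 ((D + G) * (D + G - A) / 2) 0
        (- ((A + G) * (A + G - D) / 2)) (- ((A + D) * (A + D - G) / 2)))].
Proof.
move=> M.
have e1 : 2 * x1 = 0 by jac M b1 b2 b3 2%N.
have e2 : 2 * y1 = 0 by jac M b1 b2 b3 3%N.
have e5 : -2 * x2 = 0 by jac M b1 b2 b4 2%N.
have e6 : -2 * x3 -A*D -A*G +D*D +2*D*G +G*G = 0 by jac M b1 b3 b4 2%N.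
have e7 : - 2*y2 -A*A +A*D -2*A*G +D*G -G*G = 0 by jac M b1 b2 b4 3%N.
have e8 : 2 * z1 + A*A+2*A*D-A*G+D*D-D*G = 0 by jac M b1 b2 b3 4%N.
have f1 : A * x3 - D * x3 - D * z1 - G * z1 = 0 by jac M b1 b3 b5 2%N.
have f2 : A * x3 + D * y2 + G * x3 + G * y2 = 0 by jac M b2 b4 b5 2%N.
have f3 : - A * y2 + A * z1 + D * y2 + G * z1 = 0 by jac M b1 b2 b5 3%N.
have x1E : x1 = 0 by lra.
have y1E : y1 = 0 by lra.
have x2E : x2 = 0 by lra.
have x3E : x3 = (D + G) * (D + G - A) / 2 by lra.
have y2E : y2 = - ((A + G) * (A + G - D) / 2) by lra.
have z1E : z1 = - ((A + D) * (A + D - G) / 2) by lra.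
by subst; split=> //; [rewrite -[RHS]f1 | rewrite -[RHS]oppr0 -[in RHS]f3 |
  rewrite -[RHS]f2]; field.
Qed.

Lemma hbr_swap g (A D G x3 y2 z1 : R) :
  modelled g (hbr 0 A 0 0 D 0 G 0 0 x3 0 y2 z1) ->
  modelled g (hbr 0 D 0 0 A 0 G 0 0 (- y2) 0 (- x3) z1).
Proof.
(* A quarter turn exchanges the two axes. *)
move=> M; have cs : 0 ^+ 2 + 1 ^+ 2 = 1 :> R by ring.
by move: (hbr_rotate cs M); congr (modelled g (hbr _ _ _ _ _ _ _ _ _ _ _ _ _));
  ring.
Qed.

(** Dividing by [C] makes both [D * (A + G)] and [D * (A + 3 * D + G)] vanish; their difference is
    three times the square of [D]. *)
Lemma hbr_off_diag g (A C D G x1 x2 x3 y1 y2 z1 : R) : C != 0 ->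
  modelled g (hbr 0 A 0 C D 0 G x1 x2 x3 y1 y2 z1) ->
  [/\ D = 0, (A + G) * (A * G - C ^+ 2) = 0 &
   modelled g (hbr_edge A C G)].
Proof.
move=> C0 M.
have e1 : 2 * x1 - A * C - 3 * C * D - C * G = 0 by jac M b1 b2 b3 2%N.
have e2 : 2 * y1 = 0 by jac M b1 b2 b3 3%N.
have e5 : -2 * x2 = 0 by jac M b1 b2 b4 2%N.
have e6 : -2 * x3 -A*D -A*G +2*C*C+D*D +2*D*G +G*G = 0 by jac M b1 b3 b4 2%N.
have e7 : - 2*y2 -A*A +A*D -2*A*G +D*G -G*G = 0 by jac M b1 b2 b4 3%N.
have e8 : 2 * z1 + A*A+2*A*D-A*G+2*C*C+D*D-D*G = 0 by jac M b1 b2 b3 4%N.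
have f1 : - A * x1 - C * y2 - G * x1 = 0 by jac M b1 b4 b5 3%N.
have f2 : A * x1 + C * x3 + C * z1 + 2 * D * x1 - G * x1 =
  0 by jac M b1 b3 b5 4%N.
have f3 : A * x3 + D * y2 + G * x3 + G * y2 = 0 by jac M b2 b4 b5 2%N.
have x1E : x1 = C * (A + 3 * D + G) / 2 by lra.
have y1E : y1 = 0 by lra.
have x2E : x2 = 0 by lra.
have x3E : x3 = (D + G) * (D + G - A) / 2 + C ^+ 2 by lra.
have y2E : y2 = - ((A + G) * (A + G - D) / 2) by lra.
have z1E : z1 = - ((A + D) * (A + D - G) / 2 + C ^+ 2) by lra.
subst.
have d1 : D * (A + G) = 0.
  apply: (mulfI C0); apply: (mulfI (_ : 2 != 0 :> R));
    first by rewrite pnatr_eq0.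
  by rewrite !mulr0 -[RHS]oppr0 -[in RHS]f1; field.
have D0 : D = 0.
  have d2 : D * (A + 3 * D + G) = 0.
    by apply: (mulfI C0); rewrite mulr0 -[RHS]f2; field.
  have : 3 * (D * D) = 0 by rewrite -[RHS]d2 -[in RHS](subr0 (_ * _)) -d1; ring.
  by move/eqP; rewrite !mulf_eq0 pnatr_eq0 /= orbb => /eqP.
subst; split=> //; first by rewrite -[RHS]oppr0 -[in RHS]f3; field.
by move: M; congr (modelled g (hbr _ _ _ _ _ _ _ _ _ _ _ _ _)); field.
Qed.

(** When the matrix has rank one with [G] nonzero, the forms (C/G) e^1 + e^3, e^2 and e^4 - ((A +
    G)/2) e^5 span a space stable under the differential. They are the coordinates of the perfect
    quotient, and [A + G = (C ^+ 2 + G ^+ 2) / G] is nonzero. *)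
Lemma hbr_not_solvable g (A C G : R) : G != 0 -> A * G = C ^+ 2 ->
  modelled g (hbr_edge A C G) ->
  ~ lie_solvable g.
Proof.
move=> G0 AG [e [el [e' eK e'K] eB]].
have G2 : 0 < G ^+ 2 by rewrite exprn_even_gt0.
have CG0 : C ^+ 2 + G ^+ 2 != 0 by rewrite gt_eqF // ltr_wpDl ?sqr_ge0.
have AE : A = C ^+ 2 / G by rewrite -AG mulfK.
have T0 : A + G != 0.
  have -> : A + G = (C ^+ 2 + G ^+ 2) / G by rewrite AE; field.
  by rewrite mulf_neq0 ?invr_neq0.
apply: (@perfect_quotient_not_solvable _ g
  (fun x => C / G * co (e x) 0 + co (e x) 2) (fun x => co (e x) 1)
  (fun x => co (e x) 3 - (A + G) / 2 * co (e x) 4) (A + G) C G) => //.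
- by move=> c x y; rewrite el !(coD, coZ) /GRing.scale /=; ring.
- by move=> c x y; rewrite el !(coD, coZ).
- by move=> c x y; rewrite el !(coD, coZ) /GRing.scale /=; ring.
- by move=> x y; rewrite eB !co_hbr //= AE; field.
- by move=> x y; rewrite eB !co_hbr //= AE; field.
- by move=> x y; rewrite eB !co_hbr //= AE; field.
- move=> c1 c2 c3; exists (e' (row5 [:: 0; c2; c1; c3; 0])).
  by rewrite e'K !co_row5 //=; split; ring.
Qed.

(** * Normalisation by rotation, and the case analysis *)

Lemma unit_vector (p q : R) : (p != 0) || (q != 0) -> exists n c s,
  [/\ n != 0, c ^+ 2 + s ^+ 2 = 1, p = n * c & q = n * s].
Proof.
move=> pq; pose n := Num.sqrt (p ^+ 2 + q ^+ 2).
have pq0 : 0 < p ^+ 2 + q ^+ 2.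
  by rewrite lt_neqAle addr_ge0 ?sqr_ge0 // eq_sym paddr_eq0 ?sqr_ge0 //
    !expf_eq0 /= negb_and pq.
have n2 : n ^+ 2 = p ^+ 2 + q ^+ 2 by rewrite sqr_sqrtr // ltW.
have n0 : n != 0 by rewrite sqrtr_eq0 -ltNge.
exists n, (p / n), (q / n); split; rewrite // ?[n * _]mulrC ?divfK //.
by rewrite !expr_div_n -mulrDl -n2 divff ?expf_neq0.
Qed.

Lemma diagonalize2 (A B D : R) : exists c s,
  c ^+ 2 + s ^+ 2 = 1 /\ (c ^+ 2 - s ^+ 2) * B - c * s * (A - D) = 0.
Proof.
have [-> | B0] := eqVneq B 0; first by exists 1, 0; split; ring.
(* [(B, m)] is an eigenvector of [A B; B D] for the larger eigenvalue [(A + D + w) / 2]. *)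
pose w := Num.sqrt ((A - D) ^+ 2 + 4 * B ^+ 2); pose m := (D - A + w) / 2.
have w2 : w ^+ 2 = (A - D) ^+ 2 + 4 * B ^+ 2.
  by rewrite sqr_sqrtr // addr_ge0 ?sqr_ge0 // mulr_ge0 ?ler0n ?sqr_ge0.
have [|n [c [s [n0 cs Bn mn]]]] := @unit_vector B m; first by rewrite B0.
exists c, s; split=> //; apply: (mulfI (expf_neq0 2 n0)).
have -> : n ^+ 2 * ((c ^+ 2 - s ^+ 2) * B - c * s * (A - D)) =
   ((n * c) ^+ 2 - (n * s) ^+ 2) * B - (n * c) * (n * s) * (A - D) by ring.
by rewrite -Bn -mn /m; field: w2.
Qed.

Local Ltac chg := congr (modelled _ (hbr _ _ _ _ _ _ _ _ _ _ _ _ _)).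

(** The second and third alternatives are the lines of [h2] and [h3]. In the others [A] or [D] is
    zero, and the matrix has rank at most one or trace zero. *)
Lemma diag_cases (A D G : R) : D * (D + G) * (2 * A - G) = 0 ->
  A * (A + G) * (2 * D - G) = 0 -> (A + G) * (D + G) * (D - A) = 0 ->
  [\/ A = 0 /\ D = 0, D = A /\ G = - A, D = A /\ G = 2 * A
    | (D = 0 /\ (G = 0 \/ A = - G)) \/ (A = 0 /\ (G = 0 \/ D = - G))].
Proof.
move=> /eqP E1 /eqP E2 /eqP; rewrite !mulf_eq0 in E1 E2 *.
case/orP => [/orP[] | ] /eqP E3.
- have {E3} AG : A = - G by lra.
  subst A; rewrite ?addNr ?eqxx in E1 E2; case/orP: E1 => [/orP[] | ] /eqP E1.
  + by apply: Or44; left; split; [|right].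
  + apply: Or42; split; lra.
  + have G0 : G = 0 by lra.
    by apply: Or44; right; split; [|left]; lra.
- have {E3} DG : D = - G by lra.
  subst D; case/orP: E2 => [/orP[] | ] /eqP E2.
  + by apply: Or44; right; split; [|right].
  + apply: Or42; split; lra.
  + by apply: Or44; left; split; [|left]; lra.
- have {E3} DA : D = A by lra.
  subst D; case/orP: E2 => [/orP[] | ] /eqP E2.
  + by apply: Or41.
  + by apply: Or42; split; lra.
  + by apply: Or43; split; lra.
Qed.

Definition is_h1_to_h5 (g : lieAlgType R) :=
  lie_isomorphic g (h1 R) \/ lie_isomorphic g (h2 R) \/
  lie_isomorphic g (h3 R) \/ lie_isomorphic g (h4 R) \/
  lie_isomorphic g (h5 R).

Lemma hbr_rank_le1 g (A C G : R) : lie_solvable g -> A * G = C ^+ 2 ->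
  modelled g (hbr_edge A C G) ->
  is_h1_to_h5 g.
Proof.
move=> sg AG M; have [G0 | G0] := eqVneq G 0;
  last by case: (hbr_not_solvable G0 AG M).
have C0 : C = 0 by move/eqP: AG; rewrite G0 mulr0 eq_sym expf_eq0 => /eqP.
subst; have [A0 | A0] := eqVneq A 0.
  by left; apply/hbr_h1; move: M; chg; rewrite ?A0; field.
by right; right; right; right; apply/(hbr_h5 _ A0); move: M; chg; field.
Qed.

Lemma hbr_traceless g (C G : R) : lie_solvable g ->
  modelled g (hbr_traceless_br C G) ->
  is_h1_to_h5 g.
Proof.
move=> sg M; have [K0 | K0] := eqVneq (G ^+ 2 + C ^+ 2) 0; last first.
  by right; right; right; left; apply/(hbr_h4 _ K0).
move/eqP: (K0); rewrite paddr_eq0 ?sqr_ge0 // !expf_eq0 /= =>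
  /andP[/eqP G0 /eqP C0].
by left; apply/hbr_h1; move: M; chg; rewrite ?K0 ?G0 ?C0; ring.
Qed.

Lemma hbr_diag_classification g (a A D G x1 x2 x3 y1 y2 z1 : R) :
  lie_solvable g -> modelled g (hbr a A 0 0 D 0 G x1 x2 x3 y1 y2 z1) ->
  is_h1_to_h5 g.
Proof.
move=> sg M; have [a0 | a0] := eqVneq a 0; last first.
  by right; right; left; exact: hbr_diag_ne0 a0 M.
subst a; have [E1 E2 E3 {}M] := hbr_diag0 M.
case: (diag_cases E1 E2 E3) => [[A0 D0] | [DA GA] | [DA GA] |
  [[D0 GA]|[A0 GD]]].
- apply: (@hbr_rank_le1 g 0 0 G sg); first by rewrite mul0r expr0n.
  by subst; move: M; chg; field.
- subst; have [A0 | A0] := eqVneq A 0.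
    by left; apply/hbr_h1; move: M; chg; rewrite ?A0; field.
  by right; left; apply/(hbr_h2 _ A0); move: M; chg; field.
- subst; have [A0 | A0] := eqVneq A 0.
    by left; apply/hbr_h1; move: M; chg; rewrite ?A0; field.
  have n0 : A ^+ 2 + 0 ^+ 2 != 0 by rewrite expr0n addr0 expf_neq0.
  by right; right; left; apply/(hbr_h3 _ n0); move: M; chg; field.
- subst D; case: GA => GA; subst.
    by apply: (@hbr_rank_le1 g A 0 0 sg); [ring | move: M; chg; field].
  by apply: (@hbr_traceless g 0 G sg); move: M; chg; field.
- subst A; case: GD => GD; subst; have {}M := hbr_swap M.
    by apply: (@hbr_rank_le1 g D 0 0 sg); [ring | move: M; chg; field].
  by apply: (@hbr_traceless g 0 G sg); move: M; chg; field.
Qed.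

Lemma hbr_off_diag_classification g (A B C D G x1 x2 x3 y1 y2 z1 : R) :
  C != 0 ->
  lie_solvable g -> modelled g (hbr 0 A B C D 0 G x1 x2 x3 y1 y2 z1) ->
  is_h1_to_h5 g.
Proof.
move=> C0 sg M.
have B0 : B = 0.
  (* With [a = E = 0] the first says [y1 = - B * C] and the second says [C * y1 = 0]. *)
  have f1 := hbr_y1 M; have f2 := hbr_Cy1 M.
  have y1E : y1 = - B * C by lra.
  subst y1; apply: (mulfI (expf_neq0 2 C0)); apply: (mulfI (_ : 2 != 0 :> R)).
    by rewrite pnatr_eq0.
  by rewrite !mulr0 -[in RHS]f2; ring.
subst B; have [D0 T0 {}M] := hbr_off_diag C0 M.
move/eqP: T0; rewrite mulf_eq0 => /orP[] /eqP T0.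
  have AG : A = - G by lra.
  by subst; apply: (@hbr_traceless g C G sg); move: M; chg; field.
by apply: (hbr_rank_le1 sg _ M); lra.
Qed.

Lemma hbr_classification g (a A B C D E G x1 x2 x3 y1 y2 z1 : R) :
  lie_solvable g -> modelled g (hbr a A B C D E G x1 x2 x3 y1 y2 z1) ->
  is_h1_to_h5 g.
Proof.
move=> sg M.
have [/andP[/eqP C0 /eqP E0] | CE] := boolP ((C == 0) && (E == 0)).
  have [c [s [cs dB]]] := diagonalize2 A B D.
  have := hbr_rotate cs M; rewrite dB C0 E0 !mulr0 subr0 addr0.
  exact: hbr_diag_classification.
have a0 : a = 0.
  apply/eqP; apply: contraR CE => a0; have := hbr_aC M;
    have := hbr_aE M => /eqP + /eqP.
  by rewrite !mulf_eq0 pnatr_eq0 /= (negPf a0) !orbF => -> ->.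
(* [(C, E)] turns as a vector and can be brought to [(n, 0)]. This fixes the rotation, so the entry
   [B] is left for the Jacobi identity to eliminate. *)
rewrite negb_and in CE; have [n [c [s [n0 cs Cn En]]]] := unit_vector CE.
have E0 : c * E - s * C = 0 by rewrite Cn En; ring.
have C0 : c * C + s * E = n.
  by rewrite -[RHS]mulr1 -cs Cn En; ring.
by subst a; have := hbr_rotate cs M; rewrite E0 C0;
  exact: hbr_off_diag_classification.
Qed.

End Classification.

(** * The five algebras are hypo-contact *)

Section FormConstruction.
Variables (F : numFieldType) (V : vectType F).

Definition form1 (h : V -> F) : kform V 1 := fun t => h (tnth t ord0).
Definition form2 (w : V -> V -> F) : kform V 2 :=
  fun t => w (tnth t ord0) (tnth t (lift ord0 ord0)).

Lemma tuple1_eta (t : 1.-tuple V) : exists x, t = [tuple x].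
Proof. by case/tupleP: t => x t; exists x; rewrite tuple0; apply: val_inj. Qed.

Lemma tuple2_eta (t : 2.-tuple V) : exists x y, t = [tuple x; y].
Proof.
case/tupleP: t => x t; have [y ->] := tuple1_eta t.
by exists x, y; apply: val_inj.
Qed.

Lemma tuple4_eta (t : 4.-tuple V) : exists x y z u, t = [tuple x; y; z; u].
Proof.
case/tupleP: t => x t; case/tupleP: t => y t; have [z [u ->]] := tuple2_eta t.
by exists x, y, z, u; apply: val_inj.
Qed.

Lemma form1_altform h : (forall c x y, h (c *: x + y) = c * h x + h y) ->
  is_altform (form1 h).
Proof.
move=> hl; split=> [t i c x y | t i j]; last by rewrite !ord1.
by rewrite /form1 !tnth_mktuple !ord1 eqxx hl.
Qed.

Lemma tset2 y1 y2 (i : 'I_2) (x : V) : tset [tuple y1; y2] i x =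
  [tuple if i == 0%N :> nat then x else y1; if i == 1%N :> nat then x else y2].
Proof.
apply: eq_from_tnth => j; rewrite tnth_mktuple eq_sym -(inj_eq val_inj).
by case: j => [[|[|]]] // j; rewrite /= (tnth_nth 0).
Qed.

Lemma form2_altform w : skew_bilinear w -> is_altform (form2 w).
Proof.
move=> skw; split=> [t i c x y | t i j]; have [y1 [y2 ->]] := tuple2_eta t.
  rewrite !tset2 /form2; case: i => [[|[|]]] // i /=.
    by rewrite !(tnth_nth 0) /= skw.1.
  by rewrite !(tnth_nth 0) /= (skewDr skw) (skewZr skw).
rewrite /form2; case: i j => [[|[|]]] // i [[|[|]]] // j _;
  by rewrite !(tnth_nth 0) /= => ->; exact: skewxx.
Qed.

(** The Pfaffian of the Gram matrix of [w] on four vectors, that is, half of w ^ w. *)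
Definition pfaff (w : V -> V -> F) x y z u :=
  w x y * w z u - w x z * w y u + w x u * w y z.

Definition form4 (f : V -> V -> V -> V -> F) : kform V 4 :=
  fun t => f t`_0 t`_1 t`_2 t`_3.

Lemma tset4 y1 y2 y3 y4 (i : 'I_4) (x : V) : tset [tuple y1; y2; y3; y4] i x =
  [tuple if i == 0%N :> nat then x else y1; if i == 1%N :> nat then x else y2;
         if i == 2%N :> nat then x else y3; if i == 3%N :> nat then x else y4].
Proof.
apply: eq_from_tnth => j; rewrite tnth_mktuple eq_sym -(inj_eq val_inj).
by case: j => [[|[|[|[|]]]]] // j; rewrite /= (tnth_nth 0).
Qed.

Lemma pfaff_altform w c : skew_bilinear w ->
  is_altform (form4 (fun x y z u => c * pfaff w x y z u)).
Proof.
move=> skw; have N := skewN skw; split=> [t i b x y | t i j].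
  have [y1 [y2 [y3 [y4 ->]]]] := tuple4_eta t.
  rewrite !tset4 /form4 /pfaff.
  by case: i => [[|[|[|[|]]]]] // i;
    rewrite /= !(skewDl skw, skewDr skw, skewZl skw, skewZr skw); ring.
have [y1 [y2 [y3 [y4 ->]]]] := tuple4_eta t.
rewrite /form4 /pfaff /=.
case: i j => [[|[|[|[|]]]]] // i [[|[|[|[|]]]]] // j _;
  rewrite !(tnth_nth 0) /= => E; subst;
  rewrite ?(skewxx skw) ?(N y3 y2) ?(N y4 y3) ?(N y4 y2) ?(N y2 y1) ?(N y3 y1);
    ring.
Qed.

End FormConstruction.

Section Converse.
Variables (R : realType) (g : lieAlgType R).

(** The hypo-contact equations hold identically in the parameters of [hbr], for the standard forms
    of the frame. The diagonal case with [a = 0] suffices, since each of the five algebras has a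
    representative there. *)
Lemma modelled_admits A D G x3 y2 z1 :
  modelled g (hbr 0 A 0 0 D 0 G 0 0 x3 0 y2 z1) -> admits_hypo_contact g.
Proof.
move=> [e [el [e' eK e'K] eB]].
pose m i j (x y : g) :=
  co (e x) i.-1 * co (e y) j.-1 - co (e x) j.-1 * co (e y) i.-1.
have skm i j : skew_bilinear (m i j).
  by split=> [c x y z | x y]; rewrite /m ?el ?(coD, coZ); ring.
pose o1 x y := m 1%N 2%N x y + m 3%N 4%N x y.
pose o2 x y := m 1%N 3%N x y - m 2%N 4%N x y.
pose o3 x y := m 1%N 4%N x y + m 2%N 3%N x y.
have sk1 : skew_bilinear o1.
  by split=> [c x y z | x y]; rewrite /o1 ?(skm _ _).1 ?((skm _ _).2 y x); ring.
have sk2 : skew_bilinear o2.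
  by split=> [c x y z | x y]; rewrite /o2 ?(skm _ _).1 ?((skm _ _).2 y x); ring.
have sk3 : skew_bilinear o3.
  by split=> [c x y z | x y]; rewrite /o3 ?(skm _ _).1 ?((skm _ _).2 y x); ring.
pose eta := form1 (fun x => co (e x) 4).
pose b k := e' (row5 (nth [::] [:: [:: 1; 0; 0; 0; 0]; [:: 0; 1; 0; 0; 0];
  [:: 0; 0; 1; 0; 0]; [:: 0; 0; 0; 1; 0]; [:: 0; 0; 0; 0; 1]] k)).
have f2E (w : g -> g -> R) x y : form2 w [tuple x; y] = w x y by [].
have f1E x : eta [tuple x] = co (e x) 4 by [].
have skf (w : g -> g -> R) : skew_bilinear w ->
  skew_bilinear (fun x y => form2 w [tuple x; y]) by [].
exists eta, (form2 o1), (form2 o2), (form2 o3); split.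
- split.
  + split; first by apply: form1_altform => c x y; rewrite el coD coZ.
    by exists [tuple b 4%N]; rewrite f1E /b e'K co_row5 //= oner_eq0.
  + by case=> [[|[|[|]]]] // i; rewrite (tnth_nth (form2 o1)) /=;
    exact: form2_altform.
  + exists (form4 (fun x y z u => 2 * pfaff o1 x y z u)); split.
    * exact: pfaff_altform.
    * move=> i j t; have [x [y [z [u ->]]]] := tuple4_eta t.
      case: i j => [[|[|[|]]]] // i [[|[|[|]]]] // j;
        rewrite !(tnth_nth (form2 o1)) /=;
      rewrite wedge22E; try (exact: skf);
        rewrite !f2E /form4 /= /pfaff /o1 /o2 /o3 /m /=;
      rewrite ?mul0r ?mul1r; ring.
    * exists [tuple b 0%N; b 1%N; b 2%N; b 3%N; b 4%N].
      rewrite (wedge41E _ _ _ _ _ _ sk1) // !f1E /o1 /m /b !e'K !co_row5 //=.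
      by rewrite (_ : _ + _ = 2) ?pnatr_eq0 //; ring.
  + move=> x y xy; rewrite f2E.
    have E z : o3 x z = o1 y z by exact: (xy [tuple z]).
    (* Testing on the horizontal basis expresses the horizontal part of [y] through that of [x], and
       [o2 x y] becomes a sum of four squares. *)
    have := E (b 0%N); have := E (b 1%N); have := E (b 2%N); have := E (b 3%N).
    rewrite /o1 /o2 /o3 /m /b !e'K !co_row5 //=.
    rewrite !(mulr0, mulr1, sub0r, subr0, add0r, addr0, oppr0) =>
      E3 E2 E1 /oppr_inj E0.
    have -> : co (e y) 0 = - co (e x) 2 by rewrite E1.
    have -> : co (e y) 3 = - co (e x) 1 by rewrite E2 opprK.
    rewrite -E3 -E0 (_ : _ - _ = co (e x) 0 ^+ 2 + co (e x) 2 ^+ 2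
      + (co (e x) 1 ^+ 2 + co (e x) 3 ^+ 2)); last by ring.
    by rewrite !addr_ge0 ?sqr_ge0.
- move=> t; have [x [y ->]] := tuple2_eta t.
  by rewrite CEd1E f1E f2E eB co_hbr //= /o3 /m /=; ring.
- move=> t; have [x [y [z [u ->]]]] := tuple4_eta t.
  rewrite CEd3E !wedge12E // !f1E !f2E /o1 /m !eB !co_hbr //=.
  by ring.
- move=> t; have [x [y [z [u ->]]]] := tuple4_eta t.
  rewrite CEd3E !wedge12E // !f1E !f2E /o2 /m !eB !co_hbr //=.
  by ring.
Qed.

Lemma h1_to_h5_admits : lie_isomorphic g (h1 R) \/ lie_isomorphic g (h2 R) \/
   lie_isomorphic g (h3 R) \/ lie_isomorphic g (h4 R) \/
     lie_isomorphic g (h5 R) ->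
  admits_hypo_contact g.
Proof.
have n1 : 1 != 0 :> R by exact: oner_neq0.
have n10 : 1 ^+ 2 + 0 ^+ 2 != 0 :> R by rewrite expr1n expr0n addr0.
case=> [/hbr_h1 | [/(hbr_h2 _ n1) | [/(hbr_h3 _ n10) |
  [/(hbr_h4 _ n10) | /(hbr_h5 _ n1)]]]]; exact: modelled_admits.
Qed.
End Converse.

(** * Adapted frames *)

Section LinearAlgebra.
Variables (F : numFieldType) (V : vectType F).

Lemma span5 (t1 t2 t3 t4 t5 : V) : \dim {:V} = 5 ->
  (forall c1 c2 c3 c4 c5 : F,
     c1 *: t1 + c2 *: t2 + c3 *: t3 + c4 *: t4 + c5 *: t5 = 0 ->
     [/\ c1 = 0, c2 = 0, c3 = 0, c4 = 0 & c5 = 0]) ->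
  forall x, exists c1 c2 c3 c4 c5 : F,
    x = c1 *: t1 + c2 *: t2 + c3 *: t3 + c4 *: t4 + c5 *: t5.
Proof.
move=> dimV ind x; pose t := [tuple t1; t2; t3; t4; t5].
have sumE (k : 'I_5 -> F) : \sum_i k i *: t`_i = k ord0 *: t1 +
    k (lift ord0 ord0) *: t2 + k (lift ord0 (lift ord0 ord0)) *: t3 +
    k (lift ord0 (lift ord0 (lift ord0 ord0))) *: t4 +
    k (lift ord0 (lift ord0 (lift ord0 (lift ord0 ord0)))) *: t5.
  by rewrite !big_ord_recl big_ord0 /= addr0 !addrA.
have t_free : free t.
  apply/freeP => k; rewrite sumE => /ind[k1 k2 k3 k4 k5] i.
  by case: i => [[|[|[|[|[|]]]]]] // i;
    [rewrite -[RHS]k1|rewrite -[RHS]k2|rewrite -[RHS]k3|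
     rewrite -[RHS]k4|rewrite -[RHS]k5]; congr k; apply: val_inj.
have t_basis : basis_of {:V} t.
  by rewrite basisEfree t_free subvf dimV size_tuple.
by rewrite (coord_basis t_basis (memvf x)) sumE; do 5!eexists.
Qed.

(** In a basis the functionals form a matrix with independent rows, which has a right inverse. *)
Lemma functionals3_surj (p q r : V -> F) :
  linear (p : V -> F^o) -> linear (q : V -> F^o) -> linear (r : V -> F^o) ->
  (forall a b c, (forall x, a * p x + b * q x + c * r x = 0) ->
    [/\ a = 0, b = 0 & c = 0]) ->
  forall a b c, exists x, [/\ p x = a, q x = b & r x = c].
Proof.
move=> lp lq lr ind a b c.
pose v (i : 'I_(\dim {:V})) : V := (vbasis {:V})`_i.
pose f (i : 'I_3) x := [:: p x; q x; r x]`_i.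
pose M : 'M[F]_(3, \dim {:V}) := \matrix_(i, j) f i (v j).
have lf i : linear (f i : V -> F^o).
  by move=> k x y; rewrite /f; case: i => [[|[|[|]]]] //= _;
    rewrite ?lp ?lq ?lr.
have fsum i n (k : 'I_n -> F) (u : 'I_n -> V) : f i (\sum_j k j *: u j) =
  \sum_j k j * f i (u j).
  pose l : {linear V -> F^o} :=
    HB.pack (f i : V -> F^o) (GRing.isLinear.Build _ _ _ _ _ (lf i)).
  by rewrite -[f i _]/(l _) linear_sum; apply: eq_bigr => j _; rewrite linearZ.
have Mfree : row_free M.
  apply: inj_row_free => w wM0.
  have wv x :
      w 0 (inord 0) * p x + w 0 (inord 1) * q x + w 0 (inord 2) * r x = 0.
    rewrite (coord_vbasis (memvf x)).
    have E i : f i (\sum_j coord (vbasis {:V}) j x *: (vbasis {:V})`_j) =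
       \sum_j coord (vbasis {:V}) j x * M i j.
      by rewrite fsum; apply: eq_bigr => j _; rewrite mxE.
    have := E (inord 0); have := E (inord 1); have := E (inord 2).
    rewrite /f !inordK //= => -> -> ->;
      rewrite !mulr_sumr -!big_split /= big1 // => j _.
    have := congr1 (fun m => coord (vbasis {:V}) j x * fun_of_matrix m 0 j) wM0.
    rewrite /= !mxE mulr0 !big_ord_recl big_ord0 addr0 /= => e; rewrite -[RHS]e.
    have -> : inord 0 = ord0 :> 'I_3 by apply: val_inj; rewrite /= inordK.
    have -> : inord 1 = lift ord0 ord0 :> 'I_3 by apply: val_inj;
      rewrite /= inordK.
    have -> : inord 2 = lift ord0 (lift ord0 ord0) :> 'I_3 by apply: val_inj;
      rewrite /= inordK.
    by rewrite !mxE; ring.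
  have [w0 w1 w2] := ind _ _ _ wv; apply/rowP => i; rewrite mxE -(inord_val i).
  by case: i => [[|[|[|]]]].
pose z := pinvmx M *m (\col_i [:: a; b; c]`_i).
have Mz : M *m z = \col_i [:: a; b; c]`_i by rewrite mulmxA mulmxVp ?mul1mx.
exists (\sum_j z j 0 *: v j).
have E i : f i (\sum_j z j 0 *: v j) = [:: a; b; c]`_i.
  have := congr1 (fun m => fun_of_matrix m i 0) Mz; rewrite [in X in X = _]mxE.
  rewrite [in X in _ = X]mxE => <-; rewrite fsum.
  by apply: eq_bigr => j _; rewrite [M i j]mxE mulrC.
have := E (inord 0); have := E (inord 1); have := E (inord 2).
by rewrite /f !inordK //= => -> -> ->.
Qed.

Lemma skew_expand (w : V -> V -> F) t1 t2 t3 t4 t5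
    a1 a2 a3 a4 a5 b1 b2 b3 b4 b5 :
  skew_bilinear w ->
  w (a1 *: t1 + a2 *: t2 + a3 *: t3 + a4 *: t4 + a5 *: t5)
    (b1 *: t1 + b2 *: t2 + b3 *: t3 + b4 *: t4 + b5 *: t5) =
  (a1 * b2 - a2 * b1) * w t1 t2 + (a1 * b3 - a3 * b1) * w t1 t3 +
  (a1 * b4 - a4 * b1) * w t1 t4 + (a1 * b5 - a5 * b1) * w t1 t5 +
  (a2 * b3 - a3 * b2) * w t2 t3 + (a2 * b4 - a4 * b2) * w t2 t4 +
  (a2 * b5 - a5 * b2) * w t2 t5 + (a3 * b4 - a4 * b3) * w t3 t4 +
  (a3 * b5 - a5 * b3) * w t3 t5 + (a4 * b5 - a5 * b4) * w t4 t5.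
Proof.
move=> skw; have N := skewN skw.
rewrite !(skewDl skw, skewDr skw, skewZl skw, skewZr skw) !(skewxx skw).
rewrite (N t2 t1) (N t3 t1) (N t4 t1) (N t5 t1) (N t3 t2) (N t4 t2) (N t5 t2).
by rewrite (N t4 t3) (N t5 t3) (N t5 t4); ring.
Qed.

End LinearAlgebra.

(** The value of a ^ b, and the polarisation of [pfaff]: [polar w w] is twice [pfaff w]. *)
Definition polar (F : nzRingType) (V : Type) (a b : V -> V -> F) x y z u : F :=
  a x y * b z u - a x z * b y u + a x u * b y z + a y z * b x u
  - a y u * b x z + a z u * b x y.

(** Half of w ^ w ^ h. *)
Definition volume (F : numFieldType) (V : vectType F) (w : V -> V -> F)
    (h : V -> F) x1 x2 x3 x4 x5 :=
    pfaff w x2 x3 x4 x5 * h x1 - pfaff w x1 x3 x4 x5 * h x2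
  + pfaff w x1 x2 x4 x5 * h x3 - pfaff w x1 x2 x3 x5 * h x4
  + pfaff w x1 x2 x3 x4 * h x5.

(* The last two fields are d(eta ^ w_i) = 0 contracted with the Reeb vector u. *)
Record hypo_data (R : realType) (g : lieAlgType R) (h : g -> R)
    (o1 o2 o3 : g -> g -> R) : Prop := HypoData {
  hypo_lin : forall c x y, h (c *: x + y) = c * h x + h y;
  hypo_sk1 : skew_bilinear o1;
  hypo_sk2 : skew_bilinear o2;
  hypo_sk3 : skew_bilinear o3;
  hypo_12 : forall x y z u, polar o1 o2 x y z u = 0;
  hypo_13 : forall x y z u, polar o1 o3 x y z u = 0;
  hypo_23 : forall x y z u, polar o2 o3 x y z u = 0;
  hypo_pf2 : forall x y z u, pfaff o2 x y z u = pfaff o1 x y z u;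
  hypo_pf3 : forall x y z u, pfaff o3 x y z u = pfaff o1 x y z u;
  hypo_vol : exists x1 x2 x3 x4 x5, volume o1 h x1 x2 x3 x4 x5 != 0;
  hypo_pos : forall x y, (forall z, o3 x z = o1 y z) -> 0 <= o2 x y;
  hypo_contact_eq : forall x y, h (lie x y) = 2 * o3 x y;
  hypo_closed1 : forall x y z u, h x = 0 -> h y = 0 -> h z = 0 -> h u = 1 ->
    (forall v, o1 u v = 0) ->
    (forall v, o3 u v = 0) ->
    o1 (lie x y) z - o1 (lie x z) y + o1 (lie y z) x = 0;
  hypo_closed2 : forall x y z u, h x = 0 -> h y = 0 -> h z = 0 -> h u = 1 ->
    (forall v, o2 u v = 0) ->
    (forall v, o3 u v = 0) ->
    o2 (lie x y) z - o2 (lie x z) y + o2 (lie y z) x = 0 }.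

(** * From forms on tuples to functions of vectors *)

Section Curried.
Variables (R : realType) (g : lieAlgType R).

(** On three horizontal vectors and the Reeb vector [u], every term passing through d eta vanishes
    because [u] lies in the kernels of [w] and [w3]; only the terms with the factor [eta u = 1]
    remain. *)
Lemma closed_wedge (eta : kform g 1) (w w3 : kform g 2) :
  skew_bilinear (fun x y => w [tuple x; y]) ->
    skew_bilinear (fun x y => w3 [tuple x; y]) ->
  CEd eta =1 (fun t => - 2 * w3 t) -> CEd (wedge eta w) =1 (fun=> 0) ->
  forall x y z u, eta [tuple x] = 0 -> eta [tuple y] = 0 -> eta [tuple z] = 0 ->
    eta [tuple u] = 1 -> (forall v, w [tuple u; v] = 0) ->
      (forall v, w3 [tuple u; v] = 0) ->
    w [tuple lie x y; z] - w [tuple lie x z; y] + w [tuple lie y z; x] = 0.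
Proof.
move=> sk sk3 deta dw x y z u hx hy hz hu wu w3u.
have hl a b : eta [tuple lie a b] = 2 * w3 [tuple a; b].
  by have := deta [tuple a; b]; rewrite CEd1E mulNr => /oppr_inj.
have := dw [tuple x; y; z; u]; rewrite CEd3E !(wedge12E _ _ _ _ sk).
have N a b : w [tuple a; b] = - w [tuple b; a] by exact: (skewN sk).
have N3 a b : w3 [tuple a; b] = - w3 [tuple b; a] by exact: (skewN sk3).
rewrite !hl hx hy hz hu !(N _ u) !wu !(N3 _ u) !w3u => e.
by apply: oppr_inj; rewrite oppr0 -[RHS]e; ring.
Qed.

Lemma hypo_contact_data (eta : kform g 1) (w1 w2 w3 : kform g 2) :
  hypo_contact eta w1 w2 w3 ->
  hypo_data (fun x => eta [tuple x]) (fun x y => w1 [tuple x; y])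
    (fun x y => w2 [tuple x; y]) (fun x y => w3 [tuple x; y]).
Proof.
case=> -[[eta_alt _] w_alt [v [v_alt wE [t vol]]] pos] deta dw1 dw2.
have i3 (P : 'I_3 -> Prop) : (forall i, P i) ->
  [/\ P ord0, P (lift ord0 ord0) & P (lift ord0 (lift ord0 ord0))] by [].
have [a1 a2 a3] := i3 _ w_alt; rewrite !(tnth_nth w1) /= in a1 a2 a3.
have [s1 s2 s3] := And3 (altform2_skew a1) (altform2_skew a2)
  (altform2_skew a3).
have p i j x y z u (a b : kform g 2) : (i < 3)%N -> (j < 3)%N ->
    nth w1 [:: w1; w2; w3] i = a -> nth w1 [:: w1; w2; w3] j = b ->
    is_altform a -> is_altform b ->
    polar (fun x y => a [tuple x; y]) (fun x y => b [tuple x; y]) x y z u =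
    (i == j)%:R * v [tuple x; y; z; u].
  move=> i3' j3' <- <- ai aj; have := wE (inord i) (inord j) [tuple x; y; z; u].
  rewrite -(inj_eq val_inj) !(tnth_nth w1) /= !inordK // => <-.
  by rewrite wedge22E //; exact: altform2_skew.
have pfE (a : kform g 2) x y z u :
  polar (fun x y => a [tuple x; y]) (fun x y => a [tuple x; y]) x y z u
   = 2 * pfaff (fun x y => a [tuple x; y]) x y z u by rewrite /polar /pfaff;
     ring.
have pf1 x y z u : 2 * pfaff (fun x y => w1 [tuple x; y]) x y z u =
  v [tuple x; y; z; u].
  by rewrite -pfE (p 0 0)%N // eqxx mul1r.
have pf2 x y z u : 2 * pfaff (fun x y => w2 [tuple x; y]) x y z u =
  v [tuple x; y; z; u].
  by rewrite -pfE (p 1 1)%N // eqxx mul1r.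
have pf3 x y z u : 2 * pfaff (fun x y => w3 [tuple x; y]) x y z u =
  v [tuple x; y; z; u].
  by rewrite -pfE (p 2 2)%N // eqxx mul1r.
have n2 : 2 != 0 :> R by rewrite pnatr_eq0.
split=> //.
- exact: altform1_lin.
- by move=> x y z u; rewrite (p 0 1)%N // mul0r.
- by move=> x y z u; rewrite (p 0 2)%N // mul0r.
- by move=> x y z u; rewrite (p 1 2)%N // mul0r.
- by move=> x y z u; apply: (mulfI n2); rewrite pf1 pf2.
- by move=> x y z u; apply: (mulfI n2); rewrite pf1 pf3.
- case/tupleP: t vol => x1 t; have [x2 [x3 [x4 [x5 ->]]]] := tuple4_eta t =>
  vol.
  exists x1, x2, x3, x4, x5; apply: contraNneq vol => vol0.
  rewrite (_ : [tuple of _] = [tuple x1; x2; x3; x4; x5]); last exact: val_inj.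
  rewrite (wedge41E _ _ _ _ _ _ s1) => [|x y z u]; last by rewrite -pf1.
  rewrite -!/(pfaff (fun x y => w1 [tuple x; y]) _ _ _ _).
  by apply/eqP; rewrite -[RHS](mulr0 2) -vol0 /volume; ring.
- move=> x y xy; apply: pos => t'; have [z ->] := tuple1_eta t'.
  by have := xy z; rewrite /contract; congr (w3 _ = w1 _); apply: val_inj.
- by move=> x y; have := deta [tuple x; y]; rewrite CEd1E mulNr => /oppr_inj.
- by move=> x y z u; exact: (closed_wedge s1 s3 deta dw1).
- by move=> x y z u; exact: (closed_wedge s2 s3 deta dw2).
Qed.

End Curried.

(** * The Reeb vector and horizontal frames *)

Section Volume.
Variables (F : numFieldType) (V : vectType F) (w : V -> V -> F) (h : V -> F).
Hypotheses (dimV : \dim {:V} = 5) (skw : skew_bilinear w).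
Hypothesis (hl : forall c x y, h (c *: x + y) = c * h x + h y).

Lemma lin_form0 : h 0 = 0.
Proof. by have := hl (-1) 0 0; rewrite scaler0 addr0 mulN1r addNr. Qed.

Lemma lin_formD x y : h (x + y) = h x + h y.
Proof. by rewrite -[x in LHS]scale1r hl mul1r. Qed.

Lemma lin_formZ c x : h (c *: x) = c * h x.
Proof. by rewrite -[c *: x]addr0 hl lin_form0 addr0. Qed.

(** Putting a vanishing combination in place of the i-th vector kills the volume, which by
    alternation is also the i-th coefficient times the original volume. Hence the vectors are
    independent. *)
Lemma volume_span t1 t2 t3 t4 t5 : volume w h t1 t2 t3 t4 t5 != 0 ->
  forall x, exists c1 c2 c3 c4 c5 : F,
    x = c1 *: t1 + c2 *: t2 + c3 *: t3 + c4 *: t4 + c5 *: t5.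
Proof.
move=> vol0; apply: span5 => // c1 c2 c3 c4 c5; set s := _ + _ => s0.
have N := skewN skw.
have hE := (lin_formD, lin_formZ).
have wE := (skewDl skw, skewDr skw, skewZl skw, skewZr skw).
have zE := (skew0l skw, skew0r skw, lin_form0).
have v1 : volume w h s t2 t3 t4 t5 = 0 by rewrite s0 /volume /pfaff !zE; ring.
have v2 : volume w h t1 s t3 t4 t5 = 0 by rewrite s0 /volume /pfaff !zE; ring.
have v3 : volume w h t1 t2 s t4 t5 = 0 by rewrite s0 /volume /pfaff !zE; ring.
have v4 : volume w h t1 t2 t3 s t5 = 0 by rewrite s0 /volume /pfaff !zE; ring.
have v5 : volume w h t1 t2 t3 t4 s = 0 by rewrite s0 /volume /pfaff !zE; ring.
split; apply: (mulIf vol0); rewrite mul0r;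
  [rewrite -[RHS]v1 | rewrite -[RHS]v2 | rewrite -[RHS]v3
  | rewrite -[RHS]v4 | rewrite -[RHS]v5];
  rewrite /volume /pfaff /s !wE !hE !(skewxx skw) ?(N t2 t1) ?(N t3 t1)
    ?(N t4 t1) ?(N t5 t1)
    ?(N t3 t2) ?(N t4 t2) ?(N t5 t2) ?(N t4 t3) ?(N t5 t3) ?(N t5 t4); ring.
Qed.
End Volume.

Section HorizontalFrame.
Variables (R : realType) (g : lieAlgType R) (h : g -> R)
  (o1 o2 o3 : g -> g -> R).
Hypotheses (dim_g : \dim {:g} = 5) (H : hypo_data h o1 o2 o3).

Let hl := hypo_lin H.
Let s1 := hypo_sk1 H.
Let s2 := hypo_sk2 H.
Let s3 := hypo_sk3 H.
Let h0 := lin_form0 hl.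
Let hD := lin_formD hl.
Let hZ := lin_formZ hl.

(** A skew form in dimension five has in its kernel the vector of its signed 4 by 4 sub-Pfaffians.
    The three forms have equal Pfaffians, so the same [xi] serves them all. *)
Lemma horizontal_frame : exists f1 f2 f3 f4 xi,
  [/\ h xi = 1, (forall x, [/\ o1 xi x = 0, o2 xi x = 0 & o3 xi x = 0]),
      [/\ h f1 = 0, h f2 = 0, h f3 = 0 & h f4 = 0] & pfaff o1 f1 f2 f3 f4 != 0].
Proof.
have [t1 [t2 [t3 [t4 [t5 vol0]]]]] := hypo_vol H.
have sp := volume_span dim_g s1 hl vol0.
pose p1 := pfaff o1 t2 t3 t4 t5; pose p2 := pfaff o1 t1 t3 t4 t5.
pose p3 := pfaff o1 t1 t2 t4 t5; pose p4 := pfaff o1 t1 t2 t3 t5.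
pose p5 := pfaff o1 t1 t2 t3 t4; pose D := volume o1 h t1 t2 t3 t4 t5.
pose xi := D^-1 *: (p1 *: t1 - p2 *: t2 + p3 *: t3 - p4 *: t4 + p5 *: t5).
have xiE w x : skew_bilinear w ->
  (forall x y z u, pfaff w x y z u = pfaff o1 x y z u) -> w xi x = 0.
  move=> sw wo; have [c1 [c2 [c3 [c4 [c5 ->]]]]] := sp x.
  have N := skewN sw; have wE := (skewDl sw, skewDr sw, skewZl sw, skewZr sw).
  rewrite /xi -!scaleNr !wE /p1 /p2 /p3 /p4 /p5 -!wo /pfaff !(skewxx sw).
  rewrite (N t2 t1) (N t3 t1) (N t4 t1) (N t5 t1) (N t3 t2) (N t4 t2) (N t5 t2).
  by rewrite (N t4 t3) (N t5 t3) (N t5 t4); ring.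
have hxi : h xi = 1.
  by rewrite /xi -!scaleNr !(hD, hZ) -[RHS](mulVf vol0) /D /volume /p1 /p2 /p3
    /p4 /p5; ring.
have x1 x : o1 xi x = 0 by apply: xiE.
have xi0 x : [/\ o1 xi x = 0, o2 xi x = 0 & o3 xi x = 0].
  by split; apply: xiE => //; [exact: hypo_pf2 H | exact: hypo_pf3 H].
(* Projecting to ker h along [xi] does not change [o1]. One of the five sub-Pfaffians is nonzero
   since the volume is, and the projections of its vectors form the frame. *)
clearbody xi; pose u x := x - h x *: xi.
have hu x : h (u x) = 0 by rewrite /u -scaleNr hD hZ hxi mulr1 subrr.
have ou x y : o1 (u x) (u y) = o1 x y.
  rewrite /u -!scaleNr !(skewDl s1, skewDr s1, skewZl s1, skewZr s1)
    (skewN s1 x xi) !x1; ring.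
have pu x y z v : pfaff o1 (u x) (u y) (u z) (u v) =
  pfaff o1 x y z v by rewrite /pfaff !ou.
have out x y z v : pfaff o1 x y z v != 0 -> exists f1 f2 f3 f4 xi,
  [/\ h xi = 1, (forall x, [/\ o1 xi x = 0, o2 xi x = 0 & o3 xi x = 0]),
      [/\ h f1 = 0, h f2 = 0, h f3 = 0 & h f4 = 0] & pfaff o1 f1 f2 f3 f4 != 0].
  by move=> p; exists (u x), (u y), (u z), (u v), xi; rewrite !hu pu.
have [q1|/out //] := eqVneq p1 0; have [q2|/out //] := eqVneq p2 0.
have [q3|/out //] := eqVneq p3 0; have [q4|/out //] := eqVneq p4 0.
have [q5|/out //] := eqVneq p5 0; case/eqP: vol0.
by rewrite /volume -/p1 -/p2 -/p3 -/p4 -/p5 q1 q2 q3 q4 q5; ring.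
Qed.

Section Frame.
Variables f1 f2 f3 f4 xi : g.
Hypothesis hxi : h xi = 1.
Hypothesis xi0 : forall x, [/\ o1 xi x = 0, o2 xi x = 0 & o3 xi x = 0].
Hypotheses (hf1 : h f1 = 0) (hf2 : h f2 = 0) (hf3 : h f3 = 0) (hf4 : h f4 = 0).
Hypothesis pf0 : pfaff o1 f1 f2 f3 f4 != 0.

Lemma frame_span x : exists c1 c2 c3 c4,
  x = c1 *: f1 + c2 *: f2 + c3 *: f3 + c4 *: f4 + h x *: xi.
Proof.
have [|c1 [c2 [c3 [c4 [c5 E]]]]] :=
  @volume_span _ _ o1 h dim_g s1 hl f1 f2 f3 f4 xi _ x.
  by rewrite /volume hf1 hf2 hf3 hf4 hxi !mulr0 mulr1 subr0 addr0 subr0 add0r.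
exists c1, c2, c3, c4; rewrite {1}E; congr (_ + _ *: _).
by rewrite E !(hD, hZ) hf1 hf2 hf3 hf4 hxi; ring.
Qed.

(* The square of a1 o1 + a2 o2 + a3 o3 is |a|^2 times that of o1, so every
   nonzero combination of the three forms is nondegenerate. *)
Lemma hypo_nondegenerate a1 a2 a3 x :
  a1 ^+ 2 + a2 ^+ 2 + a3 ^+ 2 != 0 -> h x = 0 ->
  (forall y, a1 * o1 x y + a2 * o2 x y + a3 * o3 x y = 0) -> x = 0.
Proof.
move=> a0 hx wx0; pose w x y := a1 * o1 x y + a2 * o2 x y + a3 * o3 x y.
have sw : skew_bilinear w.
  split=> [c y z v | y z]; rewrite /w; first by rewrite s1.1 s2.1 s3.1; ring.
  by rewrite (skewN s1) (skewN s2) (skewN s3); ring.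
have pw : pfaff w f1 f2 f3 f4 =
  (a1 ^+ 2 + a2 ^+ 2 + a3 ^+ 2) * pfaff o1 f1 f2 f3 f4.
  have -> : pfaff w f1 f2 f3 f4 =
    a1 ^+ 2 * pfaff o1 f1 f2 f3 f4 + a2 ^+ 2 * pfaff o2 f1 f2 f3 f4
    + a3 ^+ 2 * pfaff o3 f1 f2 f3 f4 + a1 * a2 * polar o1 o2 f1 f2 f3 f4
    + a1 * a3 * polar o1 o3 f1 f2 f3 f4 + a2 * a3 * polar o2 o3 f1 f2 f3 f4.
    by rewrite /w /pfaff /polar; ring.
  by rewrite (hypo_12 H) (hypo_13 H) (hypo_23 H) (hypo_pf2 H) (hypo_pf3 H);
    ring.
have {}pw : pfaff w f1 f2 f3 f4 != 0 by rewrite pw mulf_neq0.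
have [c1 [c2 [c3 [c4 xE]]]] := frame_span x; rewrite hx scale0r addr0 in xE.
have N := skewN sw; have wE := (skewDl sw, skewDr sw, skewZl sw, skewZr sw).
have w0 y : w x y = 0 by exact: wx0.
have w0' y : w y x = 0 by rewrite N w0 oppr0.
have v1 : pfaff w x f2 f3 f4 = 0 by rewrite /pfaff !(w0, w0'); ring.
have v2 : pfaff w f1 x f3 f4 = 0 by rewrite /pfaff !(w0, w0'); ring.
have v3 : pfaff w f1 f2 x f4 = 0 by rewrite /pfaff !(w0, w0'); ring.
have v4 : pfaff w f1 f2 f3 x = 0 by rewrite /pfaff !(w0, w0'); ring.
have [e1 e2 e3 e4] : [/\ c1 = 0, c2 = 0, c3 = 0 & c4 = 0].
  split; apply: (mulIf pw); rewrite mul0r;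
  [rewrite -[RHS]v1|rewrite -[RHS]v2|rewrite -[RHS]v3|rewrite -[RHS]v4];
  rewrite /pfaff xE !wE !(skewxx sw) ?(N f2 f1) ?(N f3 f1) ?(N f4 f1)
    ?(N f3 f2) ?(N f4 f2) ?(N f4 f3); ring.
by rewrite xE e1 e2 e3 e4 !scale0r !addr0.
Qed.

Lemma hypo_riesz (b : g -> R) :
  (forall c x y, b (c *: x + y) = c * b x + b y) -> b xi = 0 ->
  exists2 x, h x = 0 & forall y, o3 x y = b y.
Proof.
move=> bl bxi.
pose p := pfaff o3 f1 f2 f3 f4.
(* The coefficients below come from the inverse of a 4 by 4 skew matrix, whose entries are, up to
   sign, entries of the matrix divided by its Pfaffian. *)
have p0 : p != 0 by rewrite /p (hypo_pf3 H).
pose c1 := b f2 * o3 f3 f4 - b f3 * o3 f2 f4 + b f4 * o3 f2 f3.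
pose c2 := - b f1 * o3 f3 f4 - o3 f1 f3 * b f4 + o3 f1 f4 * b f3.
pose c3 := o3 f1 f2 * b f4 + b f1 * o3 f2 f4 - o3 f1 f4 * b f2.
pose c4 := - o3 f1 f2 * b f3 + o3 f1 f3 * b f2 - b f1 * o3 f2 f3.
exists (p^-1 *: (c1 *: f1 + c2 *: f2 + c3 *: f3 + c4 *: f4)).
  by rewrite !(hD, hZ) hf1 hf2 hf3 hf4; ring.
move=> y; have [d1 [d2 [d3 [d4 ->]]]] := frame_span y.
have xi3 x : o3 x xi = 0 by rewrite (skewN s3); have [_ _ ->] := xi0 x;
  rewrite oppr0.
have N := skewN s3.
rewrite !(skewDl s3, skewDr s3, skewZl s3, skewZr s3) !xi3 !(skewxx s3).
rewrite !(lin_formD bl, lin_formZ bl) bxi.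
rewrite (N f2 f1) (N f3 f1) (N f4 f1) (N f3 f2) (N f4 f2) (N f4 f3).
rewrite /c1 /c2 /c3 /c4 /p /pfaff in p0 *; field; exact: p0.
Qed.

End Frame.
End HorizontalFrame.

(** Used to solve a linear equation [e = 0] for one unknown: what remains is a ring identity. *)
Lemma eq_add0 (V : zmodType) (x y e : V) : e = 0 -> x + e = y -> x = y.
Proof. by move=> -> <-; rewrite addr0. Qed.

Lemma eq_sub0 (V : zmodType) (x y e : V) : e = 0 -> x - e = y -> x = y.
Proof. by move=> -> <-; rewrite subr0. Qed.

(** * The frame determined by the closed form *)

Section Adapted.
Variables (R : realType) (g : lieAlgType R) (h : g -> R)
  (o1 o2 o3 : g -> g -> R).
Hypotheses (dim_g : \dim {:g} = 5) (H : hypo_data h o1 o2 o3).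

Let hl := hypo_lin H.
Let s1 := hypo_sk1 H.
Let s2 := hypo_sk2 H.
Let s3 := hypo_sk3 H.
Let h0 := lin_form0 hl.
Let hD := lin_formD hl.
Let hZ := lin_formZ hl.

Definition form_table (o : g -> g -> R) (e1 e2 e3 e4 : g) (t : seq R) :=
  [:: o e1 e2; o e1 e3; o e1 e4; o e2 e3; o e2 e4; o e3 e4] = t.

(** For [k = 1] this is an adapted frame, the entry -1 coming from e^42. The wedge relations leave
    [k] free, and only the positivity condition fixes its sign. *)
Definition adapted_up_to_scale k e1 e2 e3 e4 xi :=
  [/\ h xi = 1, forall x, [/\ o1 xi x = 0, o2 xi x = 0 & o3 xi x = 0],
      [/\ h e1 = 0, h e2 = 0, h e3 = 0 & h e4 = 0],
      [/\ form_table o1 e1 e2 e3 e4 [:: k; 0; 0; 0; 0; 1],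
          form_table o2 e1 e2 e3 e4 [:: 0; k; 0; 0; -1; 0]
        & form_table o3 e1 e2 e3 e4 [:: 0; 0; 1; k; 0; 0]]
    & forall x, exists c1 c2 c3 c4 c5,
       x = c1 *: e1 + c2 *: e2 + c3 *: e3 + c4 *: e4 + c5 *: xi].

Lemma closed_form_frame (al : g -> R) :
  (forall c x y, al (c *: x + y) = c * al x + al y) ->
  (exists x, al x != 0) -> (forall x y, al (lie x y) = 0) ->
  exists k e1 e2 e3 e4 xi, [/\ k != 0, adapted_up_to_scale k e1 e2 e3 e4 xi
    & forall y, al y = - o3 e4 y + al xi * h y].
Proof.
move=> all al0 al_lie.
have [f1 [f2 [f3 [f4 [xi [hxi xi0 [hf1 hf2 hf3 hf4] pf0]]]]]] :=
  horizontal_frame dim_g H.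
pose b y := - (al y - al xi * h y).
have bl c x y : b (c *: x + y) = c * b x + b y by rewrite /b all hl; ring.
have [|e4 he4 e4E] := hypo_riesz dim_g H hxi xi0 hf1 hf2 hf3 hf4 pf0 bl.
  by rewrite /b hxi; ring.
have alE y : al y = - o3 e4 y + al xi * h y by rewrite e4E /b; ring.
have ND := hypo_nondegenerate dim_g H hxi hf1 hf2 hf3 hf4 pf0.
have pf30 : pfaff o3 f1 f2 f3 f4 != 0 by rewrite (hypo_pf3 H).
(* Otherwise [al] is a nonzero multiple of [h], and its closedness forces [o3] to vanish. *)
have e40 : e4 != 0.
  apply: contraNneq pf30 => e40.
  have alE' y : al y = al xi * h y by rewrite alE e40 (skew0l s3) oppr0 add0r.
  have alxi0 : al xi != 0.
    by apply/eqP => a0; case: al0 => x; rewrite alE' a0 mul0r eqxx.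
  have o30 x y : o3 x y = 0.
    apply: (mulfI (_ : 2 * al xi != 0)); first by rewrite mulf_neq0 ?pnatr_eq0.
    by rewrite mulr0 -[RHS](al_lie x y) (alE' (lie x y)) (hypo_contact_eq H);
      ring.
  by rewrite /pfaff !o30; apply/eqP; ring.
have sur : forall a b c, exists x, [/\ o1 e4 x = a, o2 e4 x = b & o3 e4 x = c].
  apply: functionals3_surj; try exact: skew_linr.
  move=> a1 a2 a3 a0; have : ~~ (a1 ^+ 2 + a2 ^+ 2 + a3 ^+ 2 != 0).
    by apply: contra e40 => nz; apply/eqP; exact: (ND _ _ _ _ nz he4 a0).
  rewrite negbK paddr_eq0 ?addr_ge0 ?sqr_ge0 // paddr_eq0 ?sqr_ge0 //
    !expf_eq0 /=.
  by case/andP=> /andP[/eqP -> /eqP ->] /eqP ->.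
have hsur c1 c2 c3 : exists x, [/\ h x = 0, o1 e4 x = c1, o2 e4 x = c2
    & o3 e4 x = c3].
  have [x [x1 x2 x3]] := sur c1 c2 c3; exists (x - h x *: xi).
  have [y1 y2 y3] := xi0 e4.
  rewrite -scaleNr hD hZ hxi (skewDr s1) (skewZr s1) (skewDr s2) (skewZr s2)
    (skewDr s3) (skewZr s3).
  rewrite (skewN s1 e4 xi) (skewN s2 e4 xi) (skewN s3 e4 xi) y1 y2 y3 x1 x2 x3.
  by split; ring.
(* The prescribed values are those that [e4] has against e_1, e_2, e_3 in an adapted frame. *)
have [u1 [hu1 u11 u12 u13]] := hsur 0 0 (-1).
have [u2 [hu2 u21 u22 u23]] := hsur 0 1 0.
have [u3 [hu3 u31 u32 u33]] := hsur (-1) 0 0.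
have N1 := skewN s1; have N2 := skewN s2; have N3 := skewN s3.
(* Adding multiples of [e4] keeps the pairings with [e4]; the three coefficients are chosen to kill
   [o1 e1 e3], [o1 e2 e3] and [o2 e2 e3]. *)
pose e1 := u1 + o1 u1 u3 *: e4; pose e2 := u2 + o1 u2 u3 *: e4;
  pose e3 := u3 + o2 u2 u3 *: e4.
have [he1 he2 he3] : [/\ h e1 = 0, h e2 = 0 & h e3 = 0].
  by rewrite /e1 /e2 /e3 !(hD, hZ) he4 hu1 hu2 hu3; split; ring.
have E1 := (skewDl s1, skewDr s1, skewZl s1, skewZr s1).
have E2 := (skewDl s2, skewDr s2, skewZl s2, skewZr s2).
have E3 := (skewDl s3, skewDr s3, skewZl s3, skewZr s3).
have [a14 a24 a34] : [/\ o1 e1 e4 = 0, o1 e2 e4 = 0 & o1 e3 e4 = 1].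
  by rewrite /e1 /e2 /e3 !E1 !(skewxx s1) (N1 u1) (N1 u2) (N1 u3) u11 u21 u31;
    split; ring.
have [b14 b24 b34] : [/\ o2 e1 e4 = 0, o2 e2 e4 = -1 & o2 e3 e4 = 0].
  by rewrite /e1 /e2 /e3 !E2 !(skewxx s2) (N2 u1) (N2 u2) (N2 u3) u12 u22 u32;
    split; ring.
have [c14 c24 c34] : [/\ o3 e1 e4 = 1, o3 e2 e4 = 0 & o3 e3 e4 = 0].
  by rewrite /e1 /e2 /e3 !E3 !(skewxx s3) (N3 u1) (N3 u2) (N3 u3) u13 u23 u33;
    split; ring.
have [a13 a23 b23] : [/\ o1 e1 e3 = 0, o1 e2 e3 = 0 & o2 e2 e3 = 0].
  rewrite /e1 /e2 /e3 !E1 !E2 !(skewxx s1) !(skewxx s2) (N1 u1 e4) (N1 u2 e4)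
    (N2 u2 e4).
  by rewrite u11 u21 u31 u22 u32; split; ring.
clearbody e1 e2 e3.
(* The five wedge relations give the five entries still unknown, in terms of [k]. *)
have P12 := hypo_12 H e1 e2 e3 e4; have P13 := hypo_13 H e1 e2 e3 e4.
have P23 := hypo_23 H e1 e2 e3 e4; have Q2 := hypo_pf2 H e1 e2 e3 e4.
have Q3 := hypo_pf3 H e1 e2 e3 e4.
rewrite /polar /pfaff ?a14 ?a24 ?a34 ?b14 ?b24 ?b34 ?c14 ?c24 ?c34 ?a13 ?a23
  ?b23 in P12 P13 P23 Q2 Q3.
pose k := o1 e1 e2.
have b12 : o2 e1 e2 = 0 by apply: (eq_sub0 P12); ring.
have c12 : o3 e1 e2 = 0 by apply: (eq_sub0 P13); ring.
have c13 : o3 e1 e3 = 0 by apply: (eq_sub0 P23); ring.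
have b13 : o2 e1 e3 = k by rewrite /k; apply: etrans (etrans _ Q2) _; ring.
have c23 : o3 e2 e3 = k by rewrite /k; apply: etrans (etrans _ Q3) _; ring.
have xi4 x : [/\ o1 x xi = 0, o2 x xi = 0 & o3 x xi = 0].
  by rewrite (N1 x) (N2 x) (N3 x); have [-> -> ->] := xi0 x; rewrite oppr0.
have sp : forall x, exists c1 c2 c3 c4 c5,
    x = c1 *: e1 + c2 *: e2 + c3 *: e3 + c4 *: e4 + c5 *: xi.
  apply: span5 => // c1 c2 c3 c4 c5 /[dup] s0.
  move: s0 => /[dup] /(congr1 h) + /[dup] /(congr1 (o1^~ e4))
    + /[dup] /(congr1 (o2^~ e4)) +
    /[dup] /(congr1 (o3^~ e4)) + /(congr1 (o1^~ e3)).
  have [z1 z2 z3] := xi0 e4; have [z4 _ _] := xi0 e3.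
  rewrite !(hD, hZ) !E1 !E2 !E3 !(skewxx s1) !(skewxx s2) !(skewxx s3) h0.
  rewrite !(skew0l s1) (skew0l s2) (skew0l s3) he1 he2 he3 he4 hxi z1 z2 z3 z4.
  rewrite a14 a24 a34 b14 b24 b34 c14 c24 c34 a13 a23 (N1 e4 e3) a34.
  move=> r1 r2 r3 r4 r5 _; split;
    [apply: (eq_sub0 r4) | apply: (eq_add0 r3) | apply: (eq_sub0 r2)
    | apply: (eq_add0 r5) | apply: (eq_sub0 r1)]; ring.
exists k, e1, e2, e3, e4, xi; split=> //; last first.
  split=> //; split; rewrite /form_table.
  - by rewrite a13 a14 a23 a24 a34.
  - by rewrite b12 b13 b14 b23 b24 b34.
  - by rewrite c12 c13 c14 c23 c24 c34.
apply/eqP => k0.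
have e20 : e2 = 0.
  apply: (ND 1 0 0) => // [|y]; first by rewrite expr1n expr0n !addr0 oner_neq0.
  rewrite !mul0r !addr0 mul1r; have [d1 [d2 [d3 [d4 [d5 ->]]]]] := sp y.
  rewrite !E1 (skewxx s1) (N1 e2 e1) -/k k0 a23 a24.
  by have [-> _ _] := xi4 e2; ring.
by move/eqP: b24; rewrite e20 (skew0l s2) eq_sym oppr_eq0 oner_eq0.
Qed.

End Adapted.

(** * Structure equations in the adapted frame *)

Section Structure.
Variables (R : realType) (g : lieAlgType R) (h : g -> R)
  (o1 o2 o3 : g -> g -> R).
Hypothesis (H : hypo_data h o1 o2 o3).

Let hl := hypo_lin H.
Let s1 := hypo_sk1 H.
Let s2 := hypo_sk2 H.
Let s3 := hypo_sk3 H.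
Let h0 := lin_form0 hl.
Let hD := lin_formD hl.
Let hZ := lin_formZ hl.
Let E1 := (skewDl s1, skewDr s1, skewZl s1, skewZr s1).
Let E2 := (skewDl s2, skewDr s2, skewZl s2, skewZr s2).
Let E3 := (skewDl s3, skewDr s3, skewZl s3, skewZr s3).

Lemma adapted_normalize k e1 e2 e3 e4 xi : k != 0 ->
  adapted_up_to_scale h o1 o2 o3 k e1 e2 e3 e4 xi ->
  exists s, adapted_up_to_scale h o1 o2 o3 1 (s^-1 *: e1) (s^-1 *: e2)
    (s^-1 *: e3) (s *: e4) xi.
Proof.
move=> k0 [hxi xi0 [he1 he2 he3 he4] [t1 t2 t3] sp].
case: t1 => a12 a13 a14 a23 a24 a34; case: t2 => b12 b13 b14 b23 b24 b34.
case: t3 => c12 c13 c14 c23 c24 c34.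
have k_ge0 : 0 <= k.
  (* Both sides are -k times the first coordinate of [z], and [o2 (k *: e4) e2] equals [k].
     Rescaling by the square root of [k] then preserves the entries with [e4] and turns [k] into
     1. *)
  have := hypo_pos H (_ : forall z, o3 (k *: e4) z = o1 e2 z).
  rewrite (skewZl s2) (skewN s2 e4 e2) b24 opprK mulr1; apply=> z.
  have [d1 [d2 [d3 [d4 [d5 ->]]]]] := sp z.
  have [z1 _ _] := xi0 e2; have [_ _ z3] := xi0 e4.
  rewrite !E1 !E3 (skewN s1 e2 e1) (skewN s1 e2 xi) (skewN s3 e4 e1)
    (skewN s3 e4 e2).
  rewrite (skewN s3 e4 e3) (skewN s3 e4 xi) !(skewxx s1) !(skewxx s3).
  by rewrite a12 a23 a24 c14 c24 c34 z1 z3; ring.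
have k_gt0 : 0 < k by rewrite lt_neqAle eq_sym k0.
pose s := Num.sqrt k; exists s.
have ss : s * s = k by rewrite -expr2 sqr_sqrtr.
have s0 : s != 0 by rewrite sqrtr_eq0 -ltNge.
have kE : k = s ^+ 2 by rewrite -ss.
split=> //.
- by rewrite !hZ he1 he2 he3 he4 !mulr0.
- split; rewrite /form_table.
  + rewrite !E1 a12 a13 a14 a23 a24 a34 kE; congr [:: _; _; _; _; _; _];
    by field.
  + rewrite !E2 b12 b13 b14 b23 b24 b34 kE; congr [:: _; _; _; _; _; _];
    by field.
  + rewrite !E3 c12 c13 c14 c23 c24 c34 kE; congr [:: _; _; _; _; _; _];
    by field.
- move=> x; have [d1 [d2 [d3 [d4 [d5 ->]]]]] := sp x.
  exists (s * d1), (s * d2), (s * d3), (s^-1 * d4), d5.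
  by rewrite !scalerA ![s * _]mulrC ![s^-1 * _]mulrC !mulfK // !mulfVK.
Qed.

Lemma lieN (x y : g) : lie x y = - lie y x.
Proof.
have lD u v w : lie (u + v) w = lie u w + lie v w.
  by have := lie_linearl w 1 u v; rewrite !scale1r.
have rD u v w : lie w (u + v) = lie w u + lie w v.
  by have := lie_linearr w 1 u v; rewrite !scale1r.
apply/eqP; rewrite -addr_eq0.
by have := liexx (x + y); rewrite lD !rD !liexx add0r addr0 => ->.
Qed.

Lemma lie_skew (f : g -> R) : (forall c x y, f (c *: x + y) = c * f x + f y) ->
  skew_bilinear (fun x y => f (lie x y)).
Proof.
move=> fl; split=> [c x y z | x y]; first by rewrite lie_linearl fl.
by rewrite lieN -scaleN1r (lin_formZ fl) mulN1r.
Qed.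

Lemma adapted_modelled a e1 e2 e3 e4 xi :
  adapted_up_to_scale h o1 o2 o3 1 e1 e2 e3 e4 xi ->
  (forall x y, o3 e4 (lie x y) = 2 * a * o3 x y) ->
  exists A B C D E G x1 x2 x3 y1 y2 z1,
    modelled g (hbr a A B C D E G x1 x2 x3 y1 y2 z1).
Proof.
move=> [hxi xi0 [he1 he2 he3 he4] [t1 t2 t3] sp] closed.
case: t1 => a12 a13 a14 a23 a24 a34; case: t2 => b12 b13 b14 b23 b24 b34.
case: t3 => c12 c13 c14 c23 c24 c34.
have N1 := skewN s1; have N2 := skewN s2; have N3 := skewN s3.
have xi1 x : o1 x xi = 0 by rewrite N1; have [-> _ _] := xi0 x; rewrite oppr0.
have xi2 x : o2 x xi = 0 by rewrite N2; have [_ -> _] := xi0 x; rewrite oppr0.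
have xi3 x : o3 x xi = 0 by rewrite N3; have [_ _ ->] := xi0 x; rewrite oppr0.
(* The coordinates are contractions of the three forms, so the closure equations speak directly of
   coordinates of brackets. *)
pose y1 x := - o3 e4 x; pose y2 x := o1 e1 x; pose y3 x := o2 e1 x;
  pose y4 x := o3 e1 x.
have l1 c x y : y1 (c *: x + y) = c * y1 x + y1 y by rewrite /y1 !E3; ring.
have l2 c x y : y2 (c *: x + y) = c * y2 x + y2 y by rewrite /y2 !E1; ring.
have l3 c x y : y3 (c *: x + y) = c * y3 x + y3 y by rewrite /y3 !E2; ring.
have l4 c x y : y4 (c *: x + y) = c * y4 x + y4 y by rewrite /y4 !E3; ring.
pose comb c1 c2 c3 c4 c5 := c1 *: e1 + c2 *: e2 + c3 *: e3 + c4 *: e4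
  + c5 *: xi.
have combE c1 c2 c3 c4 c5 : let x := comb c1 c2 c3 c4 c5 in
   [/\ y1 x = c1, y2 x = c2, y3 x = c3, y4 x = c4 & h x = c5].
  rewrite /= /comb /y1 /y2 /y3 /y4 !(hD, hZ) !E1 !E2 !E3 !(skewxx s1)
    !(skewxx s2) !(skewxx s3).
  rewrite (N3 e4 e1) (N3 e4 e2) (N3 e4 e3) a12 a13 a14 b12 b13 b14 c12 c13 c14
    c24 c34.
  by rewrite xi1 xi2 !xi3 he1 he2 he3 he4 hxi; split; ring.
have xE x : x = comb (y1 x) (y2 x) (y3 x) (y4 x) (h x).
  have [c1 [c2 [c3 [c4 [c5 xE]]]]] := sp x;
    rewrite -/(comb c1 c2 c3 c4 c5) in xE.
  by rewrite xE; have [-> -> -> -> ->] := combE c1 c2 c3 c4 c5.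
pose e x := row5 [:: y1 x; y2 x; y3 x; y4 x; h x].
pose e' u := comb (co u 0) (co u 1) (co u 2) (co u 3) (co u 4).
have eK : cancel e e' by move=> x; rewrite /e' /e !co_row5 //=.
have e'K : cancel e' e.
  move=> u; rewrite /e /e'; apply: co_inj => k k5; rewrite co_row5 //.
  have [-> -> -> -> ->] := combE (co u 0) (co u 1) (co u 2) (co u 3) (co u 4).
  by case: k k5 => [|[|[|[|[|]]]]].
have r1 v : [/\ o1 v e1 = - y2 v, o1 v e2 = y1 v, o1 v e3 = - y4 v
    & o1 v e4 = y3 v].
  rewrite {1 3 5 7}(xE v) /comb !E1 !(skewxx s1) (N1 e2 e1) (N1 e3 e1)
    (N1 e4 e1).
  rewrite (N1 e3 e2) (N1 e4 e2) (N1 e4 e3) a12 a13 a14 a23 a24 a34.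
  have [-> _ _] := xi0 e1; have [-> _ _] := xi0 e2; have [-> _ _] := xi0 e3.
  have [-> _ _] := xi0 e4; split; ring.
have r2 v : [/\ o2 v e1 = - y3 v, o2 v e2 = y4 v, o2 v e3 = y1 v
    & o2 v e4 = - y2 v].
  rewrite {1 3 5 7}(xE v) /comb !E2 !(skewxx s2) (N2 e2 e1) (N2 e3 e1)
    (N2 e4 e1).
  rewrite (N2 e3 e2) (N2 e4 e2) (N2 e4 e3) b12 b13 b14 b23 b24 b34.
  have [_ -> _] := xi0 e1; have [_ -> _] := xi0 e2; have [_ -> _] := xi0 e3.
  have [_ -> _] := xi0 e4; split; ring.
have r3 v : [/\ o3 v e1 = - y4 v, o3 v e2 = - y3 v, o3 v e3 = y2 v
    & o3 v e4 = y1 v].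
  rewrite {1 3 5 7}(xE v) /comb !E3 !(skewxx s3) (N3 e2 e1) (N3 e3 e1)
    (N3 e4 e1).
  rewrite (N3 e3 e2) (N3 e4 e2) (N3 e4 e3) c12 c13 c14 c23 c24 c34.
  have [_ _ ->] := xi0 e1; have [_ _ ->] := xi0 e2; have [_ _ ->] := xi0 e3.
  have [_ _ ->] := xi0 e4; split; ring.
have L1 x y : y1 (lie x y) = - (2 * a * o3 x y) by rewrite /y1 closed.
have L5 x y : h (lie x y) = 2 * o3 x y by exact: (hypo_contact_eq H).
have z1 v : o1 xi v = 0 by have [] := xi0 v.
have z2 v : o2 xi v = 0 by have [] := xi0 v.
have z3 v : o3 xi v = 0 by have [] := xi0 v.
have cl1 x y z : h x = 0 -> h y = 0 -> h z = 0 ->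
    o1 (lie x y) z - o1 (lie x z) y + o1 (lie y z) x = 0.
  by move=> hx hy hz; exact: (hypo_closed1 H hx hy hz hxi).
have cl2 x y z : h x = 0 -> h y = 0 -> h z = 0 ->
    o2 (lie x y) z - o2 (lie x z) y + o2 (lie y z) x = 0.
  by move=> hx hy hz; exact: (hypo_closed2 H hx hy hz hxi).
(* This is d w3 = 0, obtained by applying [h] to the Jacobi identity; unlike the two preceding
   equations it holds on all vectors. *)
have cl3 x y z : o3 (lie x y) z - o3 (lie x z) y + o3 (lie y z) x = 0.
  have := congr1 h (lie_jacobi x y z); rewrite !hD !L5 h0 => j.
  rewrite (lieN x z) -scaleN1r (skewZl s3).
  rewrite (N3 x) (N3 y) (N3 z) in j.
  have -> : o3 (lie x y) z - -1 * o3 (lie z x) y + o3 (lie y z) x =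
    - (2 * - o3 (lie y z) x + 2 * - o3 (lie z x) y + 2 * - o3 (lie x y) z) / 2
      by field.
  by rewrite j; field.
(* These are 4 + 4 + 10 equations for the 30 values of [y2], [y3], [y4] on the ten basic brackets.
   Each is solved below for one unknown, which leaves twelve. *)
have F1 := cl1 e1 e2 e3 he1 he2 he3; have F2 := cl1 e1 e2 e4 he1 he2 he4.
have F3 := cl1 e1 e3 e4 he1 he3 he4; have F4 := cl1 e2 e3 e4 he2 he3 he4.
have G1 := cl2 e1 e2 e3 he1 he2 he3; have G2 := cl2 e1 e2 e4 he1 he2 he4.
have G3 := cl2 e1 e3 e4 he1 he3 he4; have G4 := cl2 e2 e3 e4 he2 he3 he4.
have H1 := cl3 e1 e2 e3; have H2 := cl3 e1 e2 e4; have H3 := cl3 e1 e3 e4.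
have H4 := cl3 e2 e3 e4; have H5 := cl3 e1 e2 xi; have H6 := cl3 e1 e3 xi.
have H7 := cl3 e1 e4 xi; have H8 := cl3 e2 e3 xi; have H9 := cl3 e2 e4 xi.
have H10 := cl3 e3 e4 xi.
have R1 v : o1 v e1 = - y2 v by case: (r1 v).
have R2 v : o1 v e2 = y1 v by case: (r1 v).
have R3 v : o1 v e3 = - y4 v by case: (r1 v).
have R4 v : o1 v e4 = y3 v by case: (r1 v).
have S1 v : o2 v e1 = - y3 v by case: (r2 v).
have S2 v : o2 v e2 = y4 v by case: (r2 v).
have S3 v : o2 v e3 = y1 v by case: (r2 v).
have S4 v : o2 v e4 = - y2 v by case: (r2 v).
have T1 v : o3 v e1 = - y4 v by case: (r3 v).
have T2 v : o3 v e2 = - y3 v by case: (r3 v).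
have T3 v : o3 v e3 = y2 v by case: (r3 v).
have T4 v : o3 v e4 = y1 v by case: (r3 v).
have RR := (R1, R2, R3, R4, S1, S2, S3, S4, T1, T2, T3, T4, xi3).
clear R1 R2 R3 R4 S1 S2 S3 S4 T1 T2 T3 T4 r1 r2 r3 cl1 cl2 cl3 sp combE.
have EX (f : g -> R) x y : skew_bilinear (fun u v => f (lie u v)) ->
    f (lie x y) = (y1 x * y2 y - y2 x * y1 y) * f (lie e1 e2)
      + (y1 x * y3 y - y3 x * y1 y) * f (lie e1 e3)
      + (y1 x * y4 y - y4 x * y1 y) * f (lie e1 e4)
      + (y1 x * h y - h x * y1 y) * f (lie e1 xi)
      + (y2 x * y3 y - y3 x * y2 y) * f (lie e2 e3)
      + (y2 x * y4 y - y4 x * y2 y) * f (lie e2 e4)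
      + (y2 x * h y - h x * y2 y) * f (lie e2 xi)
      + (y3 x * y4 y - y4 x * y3 y) * f (lie e3 e4)
      + (y3 x * h y - h x * y3 y) * f (lie e3 xi)
      + (y4 x * h y - h x * y4 y) * f (lie e4 xi).
  by move=> sf; rewrite {1}(xE x) {1}(xE y);
    exact: (skew_expand e1 e2 e3 e4 xi _ _ _ _ _ _ _ _ _ _ sf).
have O3 x y : o3 x y = y1 x * y4 y - y4 x * y1 y + (y2 x * y3 y - y3 x * y2 y).
  rewrite {1}(xE x) {1}(xE y) (skew_expand e1 e2 e3 e4 xi
    _ _ _ _ _ _ _ _ _ _ s3).
  by rewrite c12 c13 c14 c23 c24 c34 !xi3; ring.
clearbody y1 y2 y3 y4.
rewrite !RR ?L1 ?c12 ?c13 ?c14 ?c23 ?c24 ?c34 ?xi3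
  in F1 F2 F3 F4 G1 G2 G3 G4 H1 H2 H3 H4 H5 H6 H7 H8 H9 H10.
have r34 : y4 (lie e3 e4) = - y2 (lie e1 e4).
  by apply: (eq_add0 H3); ring.
have p23 : y2 (lie e2 e3) = - y2 (lie e1 e4).
  by rewrite -r34; apply: (eq_add0 G4); ring.
have q34 : y3 (lie e3 e4) = 2 * a - y2 (lie e1 e3).
  by apply: (eq_add0 G3); ring.
have p24 : y2 (lie e2 e4) = y2 (lie e1 e3) - 4 * a.
  by apply: (eq_add0 H4); rewrite q34; ring.
have p34 : y2 (lie e3 e4) = y3 (lie e1 e3) + y4 (lie e1 e4).
  by apply: (eq_add0 F3); ring.
have p45 : y2 (lie e4 xi) = 0.
  by apply: (eq_sub0 H10); ring.
have q12 : y3 (lie e1 e2) = y2 (lie e1 e3) - 6 * a.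
  by apply: (eq_sub0 F2); rewrite p24; ring.
have r24 : y4 (lie e2 e4) = y3 (lie e1 e4).
  by apply: (eq_add0 H2); ring.
have q23 : y3 (lie e2 e3) = - y3 (lie e1 e4).
  by apply: (eq_sub0 F4); rewrite r24; ring.
have q24 : y3 (lie e2 e4) = - (y2 (lie e1 e2) + y4 (lie e1 e4)).
  by apply: (eq_add0 G2); ring.
have q35 : y3 (lie e3 xi) = - y2 (lie e2 xi).
  by apply: (eq_add0 H8); ring.
have q45 : y3 (lie e4 xi) = 0.
  by apply: (eq_add0 H9); ring.
have r12 : y4 (lie e1 e2) = y2 (lie e1 e4).
  by apply: (eq_add0 F1); rewrite p23; ring.
have r13 : y4 (lie e1 e3) = y3 (lie e1 e4).
  by apply: (eq_add0 G1); rewrite q23; ring.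
have r23 : y4 (lie e2 e3) = y2 (lie e1 e2) + y3 (lie e1 e3).
  by apply: (eq_add0 H1); ring.
have r25 : y4 (lie e2 xi) = y3 (lie e1 xi).
  by apply: (eq_add0 H5); ring.
have r35 : y4 (lie e3 xi) = - y2 (lie e1 xi).
  by apply: (eq_add0 H6); ring.
have r45 : y4 (lie e4 xi) = 0.
  by apply: (eq_add0 H7); ring.
(* The shift by [3 * a] makes the matrix symmetric: the coefficients [B + 3 * a] of m 1 3 in the
   second coordinate and [B - 3 * a] of m 1 2 in the third share the same [B]. *)
exists (y2 (lie e1 e2)), (y2 (lie e1 e3) - 3 * a), (y2 (lie e1 e4)),
  (y3 (lie e1 e3)),
  (y3 (lie e1 e4)), (y4 (lie e1 e4)), (- y2 (lie e1 xi)), (- y2 (lie e2 xi)),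
  (- y2 (lie e3 xi)), (- y3 (lie e1 xi)), (- y3 (lie e2 xi)),
    (- y4 (lie e1 xi)).
exists e; split; last 1 first.
- move=> x y; apply: co_inj => -[|[|[|[|[|?]]]]] // _;
  rewrite co_hbr // /e !co_row5 //=.
  + by rewrite L1 O3.
  + by rewrite (EX _ _ _ (lie_skew l2)) p23 p24 p34 p45; ring.
  + by rewrite (EX _ _ _ (lie_skew l3)) q12 q23 q24 q34 q35 q45; ring.
  + by rewrite (EX _ _ _ (lie_skew l4)) r12 r13 r23 r24 r25 r34 r35 r45; ring.
  + by rewrite L5 O3.
- move=> c x y; apply: co_inj => -[|[|[|[|[|?]]]]] // _;
  rewrite coD coZ /e !co_row5 //=.
- by exists e'.
Qed.

End Structure.

Local Close Scope ring_scope.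
Unset Implicit Arguments.

Theorem theorem1p1 (R : realType) (g : lieAlgType R)
    (dim_g : \dim {: g} = 5) (solv_g : lie_solvable g) :
  admits_hypo_contact g <->
  (lie_isomorphic g (h1 R) \/ lie_isomorphic g (h2 R) \/
   lie_isomorphic g (h3 R) \/ lie_isomorphic g (h4 R) \/
   lie_isomorphic g (h5 R)).
Proof.
split=> [[eta [w1 [w2 [w3 hypo]]]] | ]; last exact: h1_to_h5_admits.
have H := hypo_contact_data hypo.
have [|al [al_lin al_neq0 al_lie]] := @solvable_annihilator _ g _ solv_g.
  by rewrite dim_g.
have [k [e1 [e2 [e3 [e4 [xi [k0 ad alE]]]]]]] :=
  closed_form_frame dim_g H al_lin al_neq0 al_lie.
have [s ad'] := adapted_normalize H k0 ad.
have [|A [B [C [D [E [G [x1 [x2 [x3 [y1 [y2 [z1 M]]]]]]]]]]]] :=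
  adapted_modelled H (a := s * al xi) ad';
    last exact: hbr_classification solv_g M.
(* Normalisation has multiplied [e4] by [s], hence the Reeb component of the closed form too, so [a]
   is [s * al xi]. *)
move=> x y; rewrite (skewZl (hypo_sk3 H)).
have := alE (lie x y); rewrite al_lie (hypo_contact_eq H) => /esym/eqP.
by rewrite addrC subr_eq0 => /eqP <-; ring.
Qed.
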